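(* For each $n\in\mathbb{N}$, the number $\mathcal{O}(n)$ of distinct equivalence classes of periodic orbits of period $2n$ on an equilateral triangle is exactly $$\mathcal{O}(n)=\begin{cases}\lfloor \frac n6\rfloor, & n\equiv 1\pmod 6,\\ \lfloor \frac n6\rfloor+1, & \text{otherwise}\end{cases}\;=\;\left\lfloor\frac{n+2}{2}\right\rfloor-\left\lfloor\frac{n+2}{3}\right\rfloor .$$
   Context: Billiards. Let $R$ be the closed region bounded by the equilateral triangle $\triangle ABC$. A nonsingular trajectory is a piecewise linear constant (nonzero) speed curve $\alpha:\mathbb{R}\to R$, moving in straight lines between successive strikes on the sides, reflecting at each strike so that the angle of incidence equals the angle of reflection, and never reaching a vertex. It is periodic if $\alpha(a+t)=\alpha(b+t)$ for some $a<b$ and all $t$; its restriction to $[a,b]$ is a periodic orbit. (Iterates are included.) The period is the number of strikes on the sides during the orbit (coinciding initial and final positions counted once). The angle of incidence at a strike is the (non-obtuse) angle between the path and the side struck. Unfoldings. Place $\triangle ABC$ with $\overline{BC}$ horizontal at the bottom, as a tile of a regular tessellation $\mathcal{T}$ of the plane by congruent equilateral triangles having one family of horizontal edges. Let $\alpha$ be a periodic orbit of period $m$. Every such orbit strikes a side at some point $P$ with angle of incidence in $[30^\circ,60^\circ]$; after relabelling vertices, changing the initial point and reversing the parameter if necessary, assume $P\in\overline{BC}$, $\alpha$ begins and ends at $P$, and both (Cartesian) components of the velocity on departure from $P$ are positive. Let $\alpha_1,\dots,\alpha_m$ be the successive directed segments of $\alpha$. Reflecting the triangle successively in the edges of $\mathcal{T}$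 that the path meets, with reflections $\sigma_1,\dots,\sigma_{m-1}$ ($\sigma_1$ in the edge where $\alpha_1$ ends, $\sigma_2$ in the edge where $\sigma_1(\alpha_2)$ ends, etc.), the segments $\alpha_1,\sigma_1(\alpha_2),\dots,(\sigma_{m-1}\cdots\sigma_1)(\alpha_m)$ are collinear and their union is a directed segment $\underline{PQ}$ from $P$ to $Q=(\sigma_{m-1}\cdots\sigma_1)(P)$. Any directed segment so obtained is called an unfolding of $\alpha$. Equivalence. Periodic orbits $\alpha,\beta$ are equivalent if they have respective unfoldings $\underline{PQ}$, $\underline{RS}$ and there is a horizontal translation $\tau$ with $\underline{RS}=\tau(\underline{PQ})$. $[\alpha]$ denotes the equivalence class; its period is the period of its elements. *)

(* Defs.v *)
(* Plane geometry in Cartesian coordinates: points are pairs of reals. *)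
From HB Require Import structures.
From mathcomp Require Import all_boot all_order all_algebra.
From mathcomp Require Import all_classical all_reals all_analysis.
Set Implicit Arguments.
Unset Strict Implicit.
Unset Printing Implicit Defensive.
Import Order.TTheory GRing.Theory Num.Theory.
Import numFieldNormedType.Exports.
Local Open Scope classical_set_scope.
Local Open Scope ring_scope.

Definition plane (R : realType) := (R * R)%type.

Definition dot (R : realType) (u v : plane R) : R := u.1 * v.1 + u.2 * v.2.

(* The library norm on R * R is the sup norm, hence this Euclidean one. *)
Definition enorm (R : realType) (u : plane R) : R := Num.sqrt (dot u u).

Definition edist (R : realType) (p q : plane R) : R := enorm (p - q).

Definition isometry (R : realType) (f : plane R -> plane R) : Prop :=
  forall p q, edist (f p) (f q) = edist p q.

(* The non-obtuse angle between the lines spanned by u and v. *)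
Definition line_angle (R : realType) (u v : plane R) : R :=
  acos (`|dot u v| / (enorm u * enorm v)).

(* An edge is a pair of endpoints. *)
Definition segment (R : realType) (e : plane R * plane R) : set (plane R) :=
  [set (1 - r) *: e.1 + r *: e.2 | r in `[0, 1]].

(* Linear reflection of the vector v in the direction of the edge e. *)
Definition mirror_vec (R : realType) (e : plane R * plane R) (v : plane R) :
    plane R :=
  let d := e.2 - e.1 in (2 * dot v d / dot d d) *: d - v.

(* Reflection of the plane in the line through the edge e. *)
Definition mirror (R : realType) (e : plane R * plane R) (p : plane R) :
    plane R :=
  e.1 + mirror_vec e (p - e.1).

Record triangle (R : realType) := Triangle {
  vA : plane R; vB : plane R; vC : plane R }.

(* Equilateral, nondegenerate, with BC horizontal at the bottom and B to the
   left of C. *)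
Definition placed_equilateral (R : realType) (T : triangle R) : Prop :=
  [/\ edist (vA T) (vB T) = edist (vB T) (vC T),
      edist (vB T) (vC T) = edist (vC T) (vA T),
      (vB T).2 = (vC T).2,
      (vB T).1 < (vC T).1 & (vB T).2 < (vA T).2].

Definition vertices (R : realType) (T : triangle R) : set (plane R) :=
  [set vA T; vB T; vC T].

Definition sides (R : realType) (T : triangle R) : set (plane R * plane R) :=
  [set (vA T, vB T); (vB T, vC T); (vC T, vA T)].

Definition region (R : realType) (T : triangle R) : set (plane R) :=
  [set p | exists a b c : R, [/\ 0 <= a, 0 <= b, 0 <= c, a + b + c = 1
                               & p = a *: vA T + b *: vB T + c *: vC T]].

Definition boundary (R : realType) (T : triangle R) : set (plane R) :=
  [set p | exists2 e, sides T e & segment e p].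

(* Near t, the curve f moves on straight lines, with velocity v just before t
   (arrives) and just after t (departs). *)
Definition arrives (R : realType) (f : R -> plane R) (t : R) (v : plane R) :
    Prop :=
  \forall h \near 0^'+, f (t - h) = f t - h *: v.

Definition departs (R : realType) (f : R -> plane R) (t : R) (v : plane R) :
    Prop :=
  \forall h \near 0^'+, f (t + h) = f t + h *: v.

(* Piecewise linearity is expressed through the one-sided velocities v and w at
   each time: both have norm c (constant nonzero speed), they agree inside the
   triangle, and at a strike w is the mirror image of v.  Breakpoints are thus
   locally finite, and occur only at strikes. *)
Definition nonsingular_trajectory (R : realType) (T : triangle R)
    (f : R -> plane R) : Prop :=
  exists2 c : R, 0 < c & forall t : R,
    [/\ region T (f t), ~ vertices T (f t)
      & exists v w : plane R,
          [/\ arrives f t v /\ departs f t w,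
              enorm v = c /\ enorm w = c,
              ~ boundary T (f t) -> w = v
            & forall e, sides T e -> segment e (f t) -> w = mirror_vec e v]].

(* By periodicity the restriction of curve to [start, finish] determines curve,
   so that the triple represents this restriction. *)
Record orbit (R : realType) := Orbit {
  curve : R -> plane R; start : R; finish : R }.

Definition periodic_orbit (R : realType) (T : triangle R) (o : orbit R) :
    Prop :=
  [/\ nonsingular_trajectory T (curve o), start o < finish o
    & forall t, curve o (start o + t) = curve o (finish o + t)].

(* The half-open interval counts the coinciding ends once. *)
Definition has_period (R : realType) (T : triangle R) (o : orbit R) (m : nat) :
    Prop :=
  ([set t | start o <= t < finish o /\ boundary T (curve o t)] #= `I_m)%card.

(* f is the curve of o after a relabelling of the vertices (a symmetry phi of
   the triangle), a change of the initial point, now reached at time 0, and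
   possibly a reversal of the parameter. *)
Definition repositioned (R : realType) (T : triangle R) (o : orbit R)
    (f : R -> plane R) : Prop :=
  exists (phi : plane R -> plane R) (t0 : R) (reversed : bool),
    [/\ isometry phi, phi @` vertices T = vertices T
      & forall t, f t = phi (curve o (t0 + (-1) ^+ reversed * t))].

(* The edges of the tessellation generated by the triangle. *)
Definition tessellation_edge (R : realType) (T : triangle R)
    (e : plane R * plane R) : Prop :=
  let u := vC T - vB T in
  let w := vA T - vB T in
  exists (i j : int),
    e.1 = vB T + i%:~R *: u + j%:~R *: w /\
    [\/ e.2 = e.1 + u, e.2 = e.1 + w | e.2 = e.1 + (w - u)].

(* unfolding_map s k is the composite of the reflections in the lines of
   s 0, ..., s (k - 1), the first one being applied first. *)
Fixpoint unfolding_map (R : realType) (s : nat -> plane R * plane R) (k : nat)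
    (p : plane R) : plane R :=
  if k is k'.+1 then mirror (s k') (unfolding_map s k' p) else p.

(* The directed segment PQ is an unfolding of o.  Here tau 0, ..., tau m are
   the successive strike times of the repositioned curve f, and the reflecting
   edge s i is the edge of the tessellation where the unfolded image of the
   segment from f (tau i) to f (tau (i + 1)) ends, for 0 <= i < m - 1. *)
Definition is_unfolding (R : realType) (T : triangle R) (o : orbit R)
    (P Q : plane R) : Prop :=
  let L := finish o - start o in
  exists (f : R -> plane R) (m : nat) (tau : nat -> R)
         (s : nat -> plane R * plane R),
    [/\ repositioned T o f,
        [/\ P = f 0, segment (vB T, vC T) P
          & exists v, [/\ departs f 0 v, 0 < v.1, 0 < v.2
                        & pi / 6 <= line_angle v (vC T - vB T) <= pi / 3]],
        [/\ tau 0%N = 0, tau m = L,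
            forall i, (i < m)%N -> tau i < tau i.+1
          & tau @` [set i | (i <= m)%N] =
            [set t | 0 <= t <= L /\ boundary T (f t)]],
        forall i, (i.+1 < m)%N -> tessellation_edge T (s i) /\
          segment (s i) (unfolding_map s i (f (tau i.+1)))
      & Q = unfolding_map s m.-1 (f L)].

Definition equivalent (R : realType) (T : triangle R) (o1 o2 : orbit R) :
    Prop :=
  exists P Q P' Q' : plane R,
    [/\ is_unfolding T o1 P Q, is_unfolding T o2 P' Q'
      & exists c : R, P' = P + (c, 0) /\ Q' = Q + (c, 0)].

Definition orbit_class (R : realType) (T : triangle R) (o : orbit R) :
    set (orbit R) :=
  [set o' | periodic_orbit T o' /\ equivalent T o o'].

Definition classes_of_period (R : realType) (T : triangle R) (m : nat) :
    set (set (orbit R)) :=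
  orbit_class T @` [set o | periodic_orbit T o /\ has_period T o m].

(* Main.v *)
Require Import Defs.
From mathcomp Require Import all_boot all_order all_algebra.
From mathcomp Require Import all_classical all_reals all_analysis.
From mathcomp Require Import finmap ring lra zify.
Set Implicit Arguments.
Unset Strict Implicit.
Unset Printing Implicit Defensive.
Import Order.TTheory GRing.Theory Num.Theory.
Import numFieldNormedType.Exports.

(** Measure points from B in the basis formed by the two sides issued from B.  The
    lines of the tessellation are then the lines on which x, y or x + y is an
    integer, the squared length is proportional to q = x^2 + xy + y^2, and the
    directions between 30 and 60 degrees are those with 0 <= x <= y ([angle_cone]).
    The reflections in the lines generate a group of maps z |-> M z + c, where M is
    one of six linear maps and c is an integer vector with c1 = c2 modulo 3.  The
    triangle is a fundamental domain ([fold_exists], [fold_unique]).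

    Unfolding a trajectory gives a line along which, at each time, some element of
    the group carries the billiard to a uniform motion ([develop]), and the
    reflections prescribed by the tessellation compute such an element
    ([unfold_step]).  So the vector of an unfolding is the length of the parameter
    interval times a velocity with 0 <= x <= y.  This velocity is an image of every
    velocity of the orbit under the symmetry group of the hexagon, for which the
    cone 0 <= x <= y is a fundamental domain.  It is therefore determined by the
    invariants q and |x| + |y| + |x + y| ([cone_inj], [unfolding_vector]).  Every
    periodic orbit has an unfolding, because the unfolded line crosses the family
    of walls that makes the middle one of the three angles with it
    ([unfolding_exists]).  Unfoldings start on the base, so two orbits are
    equivalent if and only if their unfolding vectors are equal.

    Strikes are crossings of walls.  Over a displacement by an integer vector they
    number |x| + |y| + |x + y|, since a line that avoids the vertices never crosses
    two walls at once ([traj_count]).  For an orbit of period 2n, the element of the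
    group carried by one period is a translation or a glide reflection.  In both
    cases the displacement is a translation vector with |x| + |y| + |x + y| = 2n
    ([period_lattice]); in the cone it has x + y = n, 0 <= x <= y and x = y modulo 3.
    Conversely each such vector comes from folding a line with this direction that
    avoids the vertices ([fold_traj], [shape_realized]).  The classes are thus
    indexed by the integers x in a residue class modulo 3 with 0 <= x <= n / 2. *)

(** * Rhombic coordinates and the affine Weyl group *)

Section Coordinates.
Local Open Scope classical_set_scope.
Local Open Scope ring_scope.
Context {R : realType}.
Implicit Types (z v w : plane R) (x y t : R).

Lemma plane_eq z w : z.1 = w.1 -> z.2 = w.2 -> z = w.
Proof. by case: z w => [x y] [x' y'] /= -> ->. Qed.

Lemma planeE : (forall z w, (z + w).1 = z.1 + w.1) *
  (forall z w, (z + w).2 = z.2 + w.2) * (forall z, (- z).1 = - z.1) *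
  (forall z, (- z).2 = - z.2) * (forall t z, (t *: z).1 = t * z.1) *
  (forall t z, (t *: z).2 = t * z.2) *
  (forall x y, x *: (y : R^o) = x * y) * ((0 : plane R).1 = 0) * ((0 : plane R).2 = 0).
Proof. by []. Qed.

(** The square of the Euclidean norm, in units of the squared side of the
    triangle. *)
Definition qform z : R := z.1 ^+ 2 + z.1 * z.2 + z.2 ^+ 2.

(** The total rate at which a motion of velocity z crosses the three families of
    parallel lines of the tessellation.  When z is a lattice vector this is the
    number of lines crossed by a generic segment of displacement z. *)
Definition rate_sum z : R := `|z.1| + `|z.2| + `|z.1 + z.2|.

(** The three families of lines of the tessellation, on which x, y and x + y
    respectively are constant; also the three sides of the triangle. *)
Inductive axis := AX | AY | AD.

Definition ell (a : axis) z : R :=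
  match a with AX => z.1 | AY => z.2 | AD => z.1 + z.2 end.

(** Orthogonal to the lines of the family a for the form qform, and normalised
    by ell a (rootv a) = 2 so that bounce is the orthogonal reflection. *)
Definition rootv (a : axis) : plane R :=
  match a with AX => (2, -1) | AY => (-1, 2) | AD => (1, 1) end.

Definition bounce a z : plane R := z - ell a z *: rootv a.

(** The symmetric group on three letters: the linear parts of the group
    generated by the reflections in the lines of the tessellation. *)
Inductive sym3 := S1 | SR | SRR | SF of axis.

Definition lin (m : sym3) z : plane R :=
  match m with
  | S1 => z
  | SR => (- z.1 - z.2, z.1)
  | SRR => (z.2, - z.1 - z.2)
  | SF AX => (- z.1, z.1 + z.2)
  | SF AY => (z.1 + z.2, - z.2)
  | SF AD => (- z.2, - z.1)
  end.

Definition lattice z := z.1 \is a Num.int /\ z.2 \is a Num.int.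

(** The translations in that group: they preserve the colouring of the vertices
    of the tessellation by x - y modulo three. *)
Definition translation z := lattice z /\ (z.1 - z.2) / 3 \is a Num.int.

Definition wall a z := ell a z \is a Num.int.

Definition bary a z : R :=
  match a with AX => z.1 | AY => z.2 | AD => 1 - z.1 - z.2 end.

Definition bary_rate a z : R :=
  match a with AX => z.1 | AY => z.2 | AD => - z.1 - z.2 end.

Definition in_tri z := forall a, 0 <= bary a z.

(** The directions between 30 and 60 degrees. *)
Definition cone z := 0 <= z.1 <= z.2.

(** Equivalence under the group generated by the reflections, the affine Weyl
    group of type A2. *)
Definition weyl_eq z w :=
  exists m c, translation c /\ w = lin m z + c.

Local Ltac pr := apply: plane_eq; rewrite /= ?planeE /= ?planeE; ring.

Lemma linD m z w : lin m (z + w) = lin m z + lin m w.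
Proof. by case: m => [|||[]]; pr. Qed.

Lemma linN m z : lin m (- z) = - lin m z.
Proof. by case: m => [|||[]]; pr. Qed.

Lemma linZ m t z : lin m (t *: z) = t *: lin m z.
Proof. by case: m => [|||[]]; pr. Qed.

Lemma lin_comp m m' : exists m'', forall z, lin m (lin m' z) = lin m'' z.
Proof.
by case: m => [|||[]]; case: m' => [|||[]];
  first [exists S1; move=> z; pr | exists SR; move=> z; pr
       | exists SRR; move=> z; pr | exists (SF AX); move=> z; pr
       | exists (SF AY); move=> z; pr | exists (SF AD); move=> z; pr].
Qed.

Lemma lin_inv m : exists m', (forall z, lin m (lin m' z) = z) /\
  (forall z, lin m' (lin m z) = z).
Proof.
by exists (match m with SR => SRR | SRR => SR | _ => m end);
  case: m => [|||[]]; split=> z; pr.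
Qed.

Lemma bounce_lin a z : bounce a z = lin (SF a) z.
Proof. by case: a; rewrite /bounce; pr. Qed.

Lemma bounceK a z : bounce a (bounce a z) = z.
Proof. by case: a; rewrite /bounce; pr. Qed.

(** The group permutes the three families of lines, hence conjugation permutes
    the three reflections. *)
Lemma lin_bounce m a : exists b,
  (forall z, `|ell a (lin m z)| = `|ell b z|) /\
  (forall z, bounce a (lin m z) = lin m (bounce b z)).
Proof.
have nE x y : (x = y \/ x = - y) -> `|x| = `|y|.
  by case=> ->; rewrite ?normrN.
by case: m => [|||[]]; case: a;
 first [exists AX; split=> z; [|rewrite /bounce; pr] ; apply: nE => /=; (by left; ring) || (by right; ring)
      | exists AY; split=> z; [|rewrite /bounce; pr]; apply: nE => /=; (by left; ring) || (by right; ring)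
      | exists AD; split=> z; [|rewrite /bounce; pr]; apply: nE => /=; (by left; ring) || (by right; ring)].
Qed.

Lemma int_norm x : (`|x| \is a Num.int) = (x \is a Num.int).
Proof. by case: (ger0P x) => _; rewrite ?rpredN. Qed.

Lemma qform_lin m z : qform (lin m z) = qform z.
Proof. by rewrite /qform; case: m => [|||[]] /=; ring. Qed.

Lemma qformN z : qform (- z) = qform z.
Proof. by rewrite /qform !planeE; ring. Qed.

Lemma qformZ t z : qform (t *: z) = t ^+ 2 * qform z.
Proof. by rewrite /qform !planeE; ring. Qed.

Lemma rate_sumN z : rate_sum (- z) = rate_sum z.
Proof. by rewrite /rate_sum !planeE -opprD !normrN. Qed.

Lemma rate_sumZ t z : rate_sum (t *: z) = `|t| * rate_sum z.
Proof. by rewrite /rate_sum !planeE -mulrDr !normrM !mulrDr. Qed.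

Lemma rate_sum_lin m z : rate_sum (lin m z) = rate_sum z.
Proof.
have nN x y : x = - y -> `|x| = `|y| by move=> ->; rewrite normrN.
rewrite /rate_sum; case: m => [|||[]] //=.
- rewrite (nN (- z.1 - z.2) (z.1 + z.2)) ?(nN (- z.1 - z.2 + z.1) z.2); ring.
- rewrite (nN (- z.1 - z.2) (z.1 + z.2)) ?(nN (z.2 + _) z.1); ring.
- by rewrite normrN addKr addrAC.
- rewrite normrN (_ : z.1 + z.2 - z.2 = z.1); ring.
- by rewrite -opprD !normrN (addrC z.2) (addrC `|z.2|).
Qed.

Lemma qform_gt0 z : z != 0 -> 0 < qform z.
Proof.
move=> z0; rewrite lt_neqAle eq_sym /qform; apply/andP; split; last by nra.
apply: contra_neq z0 => e.
have [e1 e2] : z.1 = 0 /\ z.2 = 0.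
  have h1 : z.1 ^+ 2 <= 0 by have := sqr_ge0 (z.1 + 2 * z.2); nra.
  have h2 : z.2 ^+ 2 <= 0 by have := sqr_ge0 (z.2 + 2 * z.1); nra.
  by split; apply/eqP; rewrite -sqrf_eq0 eq_le sqr_ge0 andbT.
exact: plane_eq.
Qed.

Lemma rate_sum_cone z : cone z -> rate_sum z = 2 * (z.1 + z.2).
Proof.
by move=> /andP[h1 h2]; rewrite /rate_sum !ger0_norm; lra.
Qed.

(** In the cone, sum and product of the coordinates can be read off from the two
    invariants, and the order of the coordinates is fixed. *)
Lemma cone_inj z w : cone z -> cone w -> rate_sum z = rate_sum w ->
  qform z = qform w -> z = w.
Proof.
move=> cz cw; rewrite !rate_sum_cone // /qform => es eq.
case/andP: cz => z0 z1; case/andP: cw => w0 w1.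
have : (z.1 - w.1) * (z.1 - w.2) = 0.
  have h : z.2 = w.1 + w.2 - z.1 by lra.
  by rewrite h in eq; lra.
by move/eqP; rewrite mulf_eq0 => /orP[]/eqP h; apply: plane_eq; lra.
Qed.

(** Twelve sectors of 30 degrees: the six linear parts and their opposites form
    the symmetry group of the regular hexagon, for which the cone is a
    fundamental domain. *)
Lemma to_cone z : exists m, cone (lin m z) \/ cone (- lin m z).
Proof.
rewrite /cone.
have [?|?] := lerP 0 z.1; have [?|?] := lerP 0 z.2.
- have [?|?] := lerP z.1 z.2.
    by exists S1; left; lra.
  by exists (SF AD); right; rewrite /= ?planeE; lra.
- have [?|?] := lerP 0 (z.1 + z.2).
    have [?|?] := lerP (z.1 + z.2) (- z.2).
      by exists (SF AY); left; rewrite /= ?planeE; lra.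
    by exists SRR; right; rewrite /= ?planeE; lra.
  have [?|?] := lerP z.1 (- z.1 - z.2).
    by exists (SF AX); right; rewrite /= ?planeE; lra.
  by exists SR; left; rewrite /= ?planeE; lra.
- have [?|?] := lerP 0 (z.1 + z.2).
    have [?|?] := lerP (- z.1) (z.1 + z.2).
      by exists (SF AX); left; rewrite /= ?planeE; lra.
    by exists SR; right; rewrite /= ?planeE; lra.
  have [?|?] := lerP (- z.1 - z.2) z.2.
    by exists (SF AY); right; rewrite /= ?planeE; lra.
  by exists SRR; left; rewrite /= ?planeE; lra.
- have [?|?] := lerP z.1 z.2.
    by exists (SF AD); left; rewrite /= ?planeE; lra.
  by exists S1; right; rewrite /= ?planeE; lra.
Qed.

Lemma latticeD z w : lattice z -> lattice w -> lattice (z + w).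
Proof. by move=> [? ?] [? ?]; split; rewrite planeE rpredD. Qed.

Lemma lattice_lin m z : lattice z -> lattice (lin m z).
Proof. by case: z => x y [/= ? ?]; case: m => [|||[]]; split; rewrite //= ?rpredD ?rpredB ?rpredN. Qed.

Lemma latticeN z : lattice z -> lattice (- z).
Proof. by move=> [? ?]; split; rewrite planeE rpredN. Qed.

Lemma translation0 : translation 0.
Proof. by split; [split; rewrite planeE rpred0|rewrite !planeE subr0 mul0r rpred0]. Qed.

Lemma translationD z w : translation z -> translation w -> translation (z + w).
Proof.
move=> [? hz] [? hw]; split; first exact: latticeD.
by rewrite !planeE opprD addrACA mulrDl rpredD.
Qed.

Lemma translationN z : translation z -> translation (- z).
Proof.
by move=> [? hz]; split; [exact: latticeN|rewrite !planeE -opprD mulNr rpredN].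
Qed.

Lemma translation_lin m z : translation z -> translation (lin m z).
Proof.
move=> [lz hz]; split; first exact: lattice_lin.
case: lz => h1 h2; case: m => [|||[]] /=.
- by [].
- rewrite (_ : _ / 3 = (z.1 - z.2) / 3 - z.1); first by rewrite rpredB.
  by field.
- rewrite (_ : _ / 3 = (z.1 - z.2) / 3 + z.2); first by rewrite rpredD.
  by field.
- rewrite (_ : _ / 3 = (z.1 - z.2) / 3 - z.1); first by rewrite rpredB.
  by field.
- rewrite (_ : _ / 3 = (z.1 - z.2) / 3 + z.2); first by rewrite rpredD.
  by field.
- by rewrite opprK addrC.
Qed.

Lemma int_nat_num (n : nat) : (n%:R : R) \is a Num.int.
Proof. by rewrite rpred_nat. Qed.

Lemma translation_rootv a t : t \is a Num.int -> translation (t *: rootv a).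
Proof.
have i3 : (3 : R) != 0 by rewrite pnatr_eq0.
move=> it; split; first by case: a; split; rewrite planeE /= ?mulr1 ?mulrN1 ?rpredN ?rpredM ?int_nat_num.
case: a; rewrite !planeE /=.
- by rewrite -mulrBr opprK -[2]/(2%:R) natr1 mulfK.
- by rewrite -mulrBr -opprD addrC natr1 mulrN mulNr mulfK ?rpredN.
- by rewrite subrr mul0r rpred0.
Qed.

Lemma weyl_eq_refl z : weyl_eq z z.
Proof. by exists S1, 0; split; [exact: translation0|rewrite addr0]. Qed.

Lemma weyl_eq_sym z w : weyl_eq z w -> weyl_eq w z.
Proof.
move=> [m [c [tc ->]]]; have [m' [_ mK]] := lin_inv m.
exists m', (- lin m' c); split; first exact/translationN/translation_lin.
by rewrite linD mK addrK.
Qed.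

Lemma weyl_eq_trans z w w' : weyl_eq z w -> weyl_eq w w' -> weyl_eq z w'.
Proof.
move=> [m [c [tc ->]]] [m' [c' [tc' ->]]].
have [m'' mE] := lin_comp m' m.
exists m'', (lin m' c + c'); split.
  by apply: translationD => //; exact: translation_lin.
by rewrite linD mE addrA.
Qed.

Lemma weyl_eq_mirror a t z : t \is a Num.int ->
  weyl_eq z (bounce a z + t *: rootv a).
Proof.
move=> it; exists (SF a), (t *: rootv a); split; first exact: translation_rootv.
by rewrite -bounce_lin.
Qed.

Lemma weyl_eq_lattice z w : weyl_eq z w -> lattice z -> lattice w.
Proof.
move=> [m [c [[lc _] ->]]] lz.
by apply: latticeD => //; exact: lattice_lin.
Qed.

Lemma lattice_ell a z : lattice z -> ell a z \is a Num.int.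
Proof. by case: a => [] [? ?] //=; rewrite rpredD. Qed.

Lemma ellD a z w : ell a (z + w) = ell a z + ell a w.
Proof. by case: a; rewrite /= ?planeE; ring. Qed.

Lemma ellZ a t z : ell a (t *: z) = t * ell a z.
Proof. by case: a; rewrite /= ?planeE; ring. Qed.

Lemma bary_rateE a z t v : bary a (z + t *: v) = bary a z + t * bary_rate a v.
Proof. by case: a; rewrite /= ?planeE; ring. Qed.

(** The same permutation b of the families transports walls, rates and
    reflections, which identifies the side that is struck from the wall that is
    crossed. *)
Lemma wall_lin m a c : lattice c -> exists b,
  (forall z, wall a (lin m z + c) = wall b z) /\
  (forall z, `|ell a (lin m z)| = `|ell b z|) /\
  (forall z, bounce a (lin m z) = lin m (bounce b z)).
Proof.
move=> lc; have [b [h1 h2]] := lin_bounce m a.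
exists b; split => // z.
rewrite /wall ellD rpredDr; last exact: lattice_ell.
by rewrite -[LHS]int_norm h1 int_norm.
Qed.

Lemma weyl_eq_wall z w a : weyl_eq z w -> wall a w -> exists b, wall b z.
Proof.
move=> [m [c [[lc _] ->]]]; have [b [h _]] := wall_lin m a lc.
by rewrite h; exists b.
Qed.

Lemma two_walls a b z : wall a z -> wall b z -> a <> b -> lattice z.
Proof.
rewrite /wall /lattice; case: z => x y.
case: a; case: b => //= h1 h2 _; split => //;
  by [rewrite -(addrK y x) rpredB | rewrite -(addKr x y) rpredD ?rpredN].
Qed.

Lemma bary_wall a z : bary a z = 0 -> wall a z.
Proof.
rewrite /wall; case: a => /= h; rewrite ?h ?rpred0 //.
by rewrite (_ : z.1 + z.2 = 1) ?rpred1 //; lra.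
Qed.

Lemma int_between x : x \is a Num.int -> 0 <= x -> x <= 1 -> x = 0 \/ x = 1.
Proof.
move=> /intrP[i ->] h0 h1.
have {}h0 : (0 <= i)%R by rewrite -(ler0z R).
have {}h1 : (i <= 1)%R by rewrite -(ler_int R).
have [->|->] : i = 0 \/ i = 1 by lia.
  by left.
by right.
Qed.

Lemma tri_bounds z : in_tri z -> [/\ 0 <= z.1, 0 <= z.2, z.1 <= 1, z.2 <= 1 & z.1 + z.2 <= 1].
Proof. by move=> h; have /= := h AX; have /= := h AY; have /= := h AD; split; lra. Qed.

Lemma tri_wall a z : in_tri z -> ~ lattice z -> wall a z -> bary a z = 0.
Proof.
move=> /tri_bounds[h1 h2 h3 h4 h5] nl; rewrite /wall => wa.
have i1 : (1 : R) \is a Num.int by rewrite rpred1.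
have i0 : (0 : R) \is a Num.int by rewrite rpred0.
have nl' x y : x \is a Num.int -> y \is a Num.int -> z.1 = x -> z.2 = y -> False.
  by move=> ix iy ex ey; apply: nl; split; rewrite ?ex ?ey.
case: a wa => /= /int_between []; try lra.
- by move=> e; case: (nl' 1 0) => //; lra.
- by move=> e; case: (nl' 0 1) => //; lra.
- by move=> e; case: (nl' 0 0) => //; lra.
Qed.

(** The side a lies on the wall at level 0 or 1; k is that level. *)
Lemma bary_bounce a z t v : bary a z = 0 -> exists2 k, k \is a Num.int &
  z + t *: bounce a v = bounce a (z + t *: v) + k *: rootv a.
Proof.
case: a => /= e.
- by exists 0; rewrite ?rpred0 // /bounce; apply: plane_eq; rewrite ?planeE /= ?planeE e; ring.
- by exists 0; rewrite ?rpred0 // /bounce; apply: plane_eq; rewrite ?planeE /= ?planeE e; ring.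
- exists 1; rewrite ?rpred1 // /bounce; have e' : z.2 = 1 - z.1 by lra.
  by apply: plane_eq; rewrite ?planeE /= ?planeE e'; ring.
Qed.

Lemma bary_rate_bounce a v : bary_rate a (bounce a v) = - bary_rate a v.
Proof. by case: a; rewrite /bounce /= ?planeE /=; ring. Qed.

Lemma ell_bary_rate a v : `|ell a v| = `|bary_rate a v|.
Proof. by case: a => //=; rewrite -opprD normrN. Qed.

End Coordinates.

(** * The triangle as a fundamental domain *)

Section FundamentalDomain.
Local Open Scope classical_set_scope.
Local Open Scope ring_scope.
Context {R : realType}.
Implicit Types (z v w : plane R) (x y t : R).

(** The six symmetries of the triangle.  The linear part of such a symmetry is
    an element of the linear group above when it preserves orientation, and the
    opposite of one otherwise. *)
Definition sym (m : sym3) z : plane R :=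
  match m with
  | S1 => z
  | SR => (1 - z.1 - z.2, z.1)
  | SRR => (z.2, 1 - z.1 - z.2)
  | SF AX => (z.1, 1 - z.1 - z.2)
  | SF AY => (1 - z.1 - z.2, z.2)
  | SF AD => (z.2, z.1)
  end.

Definition sym_lin (m : sym3) z : plane R :=
  if m is SF _ then - lin m z else lin m z.

Definition sym_shift (m : sym3) : plane R := sym m 0.

Lemma symE m z : sym m z = sym_lin m z + sym_shift m.
Proof.
by case: m => [|||[]]; rewrite /sym_lin /sym_shift /sym; apply: plane_eq;
  rewrite /= ?planeE /=; ring.
Qed.

Lemma sym_in_tri m z : in_tri z -> in_tri (sym m z).
Proof.
move=> /tri_bounds[h1 h2 h3 h4 h5] a.
by case: m => [|||[]]; case: a => /=; lra.
Qed.

Lemma residue3 x : x \is a Num.int ->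
  [\/ x / 3 \is a Num.int, (x - 1) / 3 \is a Num.int | (x + 1) / 3 \is a Num.int].
Proof.
move=> /intrP[i ->].
have i3 : (3 : R) != 0 by rewrite pnatr_eq0.
have [[k e]|[[k e]|[k e]]] : (exists k, i = k * 3) \/ (exists k, i = k * 3 + 1)
   \/ (exists k, i = k * 3 - 1).
  have := divz_eq i 3; have := ltz_mod i (d := 3) isT; have := modz_ge0 i (d := 3) isT.
  move: (i %/ 3)%Z (i %% 3)%Z => q r r0 r3 e.
  have [r1|[r1|r1]] : r = 0 \/ r = 1 \/ r = 2 by lia.
  - by left; exists q; lia.
  - by right; left; exists q; lia.
  - by right; right; exists (q + 1); lia.
- by apply: Or31; rewrite e intrM mulfK // intr_int.
- by apply: Or32; rewrite e intrD intrM addrK mulfK // intr_int.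
- by apply: Or33; rewrite e intrD intrM mulrNz addrNK mulfK // intr_int.
Qed.

(** A point is a lattice point plus or minus a point of the triangle, according
    to the orientation of its cell.  The cell can be carried to the triangle in
    three ways of the right orientation, and exactly one of them respects the
    colouring of the vertices, hence lies in the group. *)
Lemma fold_exists z : exists w, in_tri w /\ weyl_eq z w.
Proof.
have key l w : lattice l -> in_tri w -> (z = l + w \/ z = l - w) ->
    exists w', in_tri w' /\ weyl_eq z w'.
  move=> ll tw hz.
  have [m' [hm1 hm2]] : exists m', z = l + (if m' is SF _ then - w else w) /\
     translation (sym_shift m' - lin m' l).
    have [il1 il2] := ll.
    have := residue3 (rpredB il1 il2).
    have i3 : (3 : R) != 0 by rewrite pnatr_eq0.
    have tr m' : (((sym_shift m' - lin m' l).1 - (sym_shift m' - lin m' l).2) / 3)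
       \is a Num.int -> translation (sym_shift m' - lin m' l).
      move=> h; split=> //; apply: latticeD; last exact/latticeN/lattice_lin.
      by case: (m') => [|||[]]; split; rewrite /sym_shift /= ?planeE ?subr0 ?rpred0 ?rpred1.
    case: hz => -> [] h.
    - exists S1; split=> //; apply: tr; rewrite /sym_shift /= ?planeE.
      by rewrite (_ : _ / 3 = - ((l.1 - l.2) / 3)) ?rpredN //; field.
    - exists SR; split=> //; apply: tr; rewrite /sym_shift /= ?planeE /=.
      rewrite (_ : _ / 3 = - ((l.1 - l.2 - 1) / 3) + l.1); first by rewrite rpredD ?rpredN.
      by field.
    - exists SRR; split=> //; apply: tr; rewrite /sym_shift /= ?planeE /=.
      rewrite (_ : _ / 3 = - ((l.1 - l.2 + 1) / 3) - l.2); first by rewrite rpredB ?rpredN.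
      by field.
    - exists (SF AD); split=> //; apply: tr; rewrite /sym_shift /= ?planeE /=.
      by rewrite (_ : _ / 3 = - ((l.1 - l.2) / 3)) ?rpredN //; field.
    - exists (SF AY); split=> //; apply: tr; rewrite /sym_shift /= ?planeE /=.
      rewrite (_ : _ / 3 = - ((l.1 - l.2 - 1) / 3) - l.2); first by rewrite rpredB ?rpredN.
      by field.
    - exists (SF AX); split=> //; apply: tr; rewrite /sym_shift /= ?planeE /=.
      rewrite (_ : _ / 3 = - ((l.1 - l.2 + 1) / 3) + l.1); first by rewrite rpredD ?rpredN.
      by field.
  exists (sym m' w); split; first exact: sym_in_tri.
  exists m', (sym_shift m' - lin m' l); split => //.
  rewrite hm1 linD symE (_ : lin m' (if m' is SF _ then - w else w) = sym_lin m' w).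
    by apply: plane_eq; rewrite !planeE; ring.
  by rewrite /sym_lin; case: (m') => // a; rewrite linN.
(* The corner of the unit rhombus of z; its two halves are cells of opposite
   orientations. *)
pose l : plane R := ((Num.floor z.1)%:~R, (Num.floor z.2)%:~R).
have ll : lattice l by split; rewrite /= intr_int.
have e1 := floor_itv z.1; have e2 := floor_itv z.2.
rewrite !intrD in e1 e2.
have [h|h] := lerP ((z - l).1 + (z - l).2) 1.
  apply: (key l (z - l)) => //; last by left; rewrite addrC subrK.
  by case; move: h; rewrite /= ?planeE /=; lra.
apply: (key (l + (1, 1)) (l + (1, 1) - z)).
- by apply: latticeD => //; split; rewrite /= rpred1.
- by case; move: h; rewrite /= ?planeE /=; lra.
- by right; rewrite subKr.
Qed.

Lemma int_two x (i : int) : x \is a Num.int -> i%:~R - 1 < x < i%:~R + 2 ->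
  x = i%:~R \/ x = i%:~R + 1.
Proof.
move=> /intrP[j ->] /andP[].
have h2 : i%:~R + 2 = (i + 2)%:~R :> R by rewrite intrD.
have h1 : i%:~R - 1 = (i - 1)%:~R :> R by rewrite intrB.
have h3 : i%:~R + 1 = (i + 1)%:~R :> R by rewrite intrD.
rewrite h1 h2 h3 !ltr_int => l1 l2.
have [->|->] : j = i \/ j = i + 1 by lia.
  by left.
by right.
Qed.

(** The linear part leaves few translations that can carry a point of the
    triangle into the triangle, and the colouring excludes those that move it. *)
Lemma fold_unique z w : in_tri z -> in_tri w -> weyl_eq z w -> z = w.
Proof.
move=> /tri_bounds[z1 z2 z3 z4 z5] /tri_bounds[w1 w2 w3 w4 w5].
move=> [m [c [[[ic1 _] ic] ew]]].
have e1 : w.1 = (lin m z).1 + c.1 by rewrite ew planeE.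
have e2 : w.2 = (lin m z).2 + c.2 by rewrite ew planeE.
have {ic} : (c.1 - c.2) / 3 = 0 \/ (c.1 - c.2) / 3 = -1 \/ (c.1 - c.2) / 3 = 1.
  have [k1|k1] := ltP ((c.1 - c.2) / 3) 0.
    case: (int_two (i := -1) ic) => [|->|->]; last 2 first.
    - by right; left.
    - by left; rewrite addNr.
    by move: e1 e2; case: (m) => [|||[]] /= *; lra.
  case: (int_two (i := 0) ic) => [|->|->]; last 2 first.
  - by left.
  - by right; right; rewrite add0r.
  by move: e1 e2; case: (m) => [|||[]] /= *; lra.
case=> [k|[k|k]].
- have ec : c.2 = c.1 by lra.
  case: (int_two (i := 0) ic1) => [|hc|hc].
  + by move: e1 e2; case: (m) => [|||[]] /= *; lra.
  + move: e1 e2; rewrite ec hc; case: (m) => [|||[]] /= e1 e2; apply: plane_eq; lra.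
  + move: e1 e2; rewrite ec hc; case: (m) => [|||[]] /= e1 e2; apply: plane_eq; lra.
- have {}k : c.2 = c.1 + 3 by lra.
  by move: e1 e2; rewrite k; case: (m) => [|||[]] /= e1 e2; apply: plane_eq; lra.
- have {}k : c.2 = c.1 - 3 by lra.
  by move: e1 e2; rewrite k; case: (m) => [|||[]] /= e1 e2; apply: plane_eq; lra.
Qed.

Lemma sym_side m a : exists b,
  (forall z, bary a (sym m z) = bary b z) /\
  (forall z, bounce a (sym_lin m z) = sym_lin m (bounce b z)).
Proof.
exists (match m, a with
  | S1, _ => a
  | SR, AX => AD | SR, AY => AX | SR, AD => AY
  | SRR, AX => AY | SRR, AY => AD | SRR, AD => AX
  | SF AX, AX => AX | SF AX, AY => AD | SF AX, AD => AY
  | SF AY, AX => AD | SF AY, AY => AY | SF AY, AD => AX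
  | SF AD, AX => AY | SF AD, AY => AX | SF AD, AD => AD
  end).
by case: m => [|||[]]; case: a; split=> z; rewrite /sym_lin /bounce /=;
  (ring || apply: plane_eq; rewrite /= ?planeE /= ?planeE /=; ring).
Qed.

Lemma sym_lattice m z : lattice (sym m z) -> lattice z.
Proof.
have h x y : 1 - x - y \is a Num.int -> x \is a Num.int -> y \is a Num.int.
  move=> h1 h2; rewrite (_ : y = 1 - (1 - x - y) - x); last by ring.
  by apply: rpredB h2; apply: rpredB h1; exact: rpred1.
have h' x y : 1 - x - y \is a Num.int -> y \is a Num.int -> x \is a Num.int.
  by rewrite addrAC; apply: h.
by case: m => [|||[]] [/= h1 h2]; split => //; move: h1 h2 => // h1 h2; do ?[exact: h h1 h2|exact: h h2 h1|exact: h' h1 h2|exact: h' h2 h1].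
Qed.

Lemma qform_sym m z : qform (sym_lin m z) = qform z.
Proof. by rewrite /sym_lin; case: m => [|||a]; rewrite ?qformN qform_lin. Qed.

Lemma rate_sum_sym m z : rate_sum (sym_lin m z) = rate_sum z.
Proof. by rewrite /sym_lin; case: m => [|||a]; rewrite ?rate_sumN rate_sum_lin. Qed.

Lemma sym_linD m z w : sym_lin m (z + w) = sym_lin m z + sym_lin m w.
Proof. by rewrite /sym_lin; case: m => [|||a]; rewrite linD ?opprD. Qed.

Lemma sym_linZ m t z : sym_lin m (t *: z) = t *: sym_lin m z.
Proof. by rewrite /sym_lin; case: m => [|||a]; rewrite linZ ?scalerN. Qed.

End FundamentalDomain.

(** * Trajectories in coordinates *)

Section Trajectories.
Local Open Scope classical_set_scope.
Local Open Scope ring_scope.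
Context {R : realType}.
Implicit Types (z v w p : plane R) (x y t q e h : R) (f g : R -> plane R).

Lemma near_rightP (P : R -> Prop) :
  (\forall h \near 0^'+, P h) <-> exists2 e : R, 0 < e & forall h : R, 0 < h < e -> P h.
Proof.
split.
  case=> e /= e0 H; exists e => // h /andP[h0 he]; apply: H => //=.
  by rewrite sub0r normrN gtr0_norm.
move=> [e e0 H]; exists e => //= h /=; rewrite sub0r normrN => he h0.
by apply: H; rewrite h0 -(gtr0_norm h0).
Qed.

(** Local rules for a trajectory are turned into global facts by this principle,
    which is the completeness of the reals. *)
Lemma real_induction (P : R -> Prop) a : P a ->
  (forall t, a <= t -> P t -> exists2 e : R, 0 < e & forall h : R, 0 < h < e -> P (t + h)) ->
  (forall t, a < t -> (forall s, a <= s < t -> P s) -> P t) ->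
  forall t, a <= t -> P t.
Proof.
move=> Pa Pr Pl t1 at1; apply: contrapT => nP.
pose S := [set t | a <= t /\ forall s, a <= s <= t -> P s].
have Sa : S a by split=> // s; rewrite -eq_le => /eqP <-.
have ubS : ubound S t1.
  move=> t [at_ Pt]; rewrite leNgt; apply/negP => t1t; apply: nP.
  by apply: Pt; rewrite at1 ltW.
have hS : has_sup S by split; [exists a|exists t1].
have aS : a <= sup S by apply: ub_le_sup => //; exists t1.
have Plt s : a <= s < sup S -> P s.
  move=> /andP[as_ ss].
  have [t [_ Pt] st] := sup_adherent (eps := sup S - s) ltac:(by rewrite subr_gt0) hS.
  by apply: Pt; rewrite as_ ltW //; move: st; rewrite subKr.
have PS : P (sup S).
  by move: aS; rewrite le_eqVlt => /predU1P[<- //|aS]; exact: Pl.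
have [e e0 He] := Pr _ aS PS.
have : S (sup S + e / 2).
  split; first by rewrite ler_wpDr // ltW // divr_gt0.
  move=> s /andP[as_ se]; have [sS|sS|->//] := ltgtP s (sup S).
    by apply: Plt; rewrite as_.
  rewrite -(subrK (sup S) s) addrC; apply: He; lra.
move=> /(ub_le_sup (ex_intro _ t1 ubS)); lra.
Qed.

Lemma scale_inj_vec t v w : t != 0 -> t *: v = t *: w -> v = w.
Proof. by move=> t0 /(congr1 (fun z => t^-1 *: z)); rewrite !scalerA mulVf // !scale1r. Qed.

Lemma departs_uniq f t v w : departs f t v -> departs f t w -> v = w.
Proof.
move=> /near_rightP[e e0 He] /near_rightP[e' e'0 He'].
have m0 : 0 < Num.min e e' / 2 by rewrite divr_gt0 // lt_min e0.
have m1 : Num.min e e' / 2 < Num.min e e' by lra.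
move: m1; rewrite lt_min => /andP[m1 m2].
have := He _ (introT andP (conj m0 m1)); rewrite (He' _ (introT andP (conj m0 m2))).
by move=> /addrI /scale_inj_vec -> //; rewrite gt_eqF.
Qed.

(** One-sided velocities are locally constant, which makes them comparable at
    nearby times. *)
Lemma departs_nearby f t v : departs f t v -> exists2 e : R, 0 < e &
  forall h : R, 0 < h < e -> f (t + h) = f t + h *: v /\ departs f (t + h) v.
Proof.
move=> /near_rightP[e e0 He]; exists e => // h /andP[h0 he].
split; first by apply: He; rewrite h0.
apply/near_rightP; exists (e - h); first by rewrite subr_gt0.
move=> k /andP[k0 kh]; rewrite -addrA !He ?h0 ?he //; last by lra.
by rewrite scalerDl addrA.
Qed.

Lemma arrives_nearby f t v : arrives f t v -> exists2 e : R, 0 < e &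
  forall h : R, 0 < h < e -> f t = f (t - h) + h *: v /\ departs f (t - h) v.
Proof.
move=> /near_rightP[e e0 He]; exists e => // h /andP[h0 he].
split; first by rewrite He ?subrK ?h0.
apply/near_rightP; exists h => // k /andP[k0 kh].
rewrite (_ : t - h + k = t - (h - k)); last by rewrite opprB addrA addrAC.
rewrite He ?He ?h0 //; last by lra.
by rewrite scalerBl opprB addrA addrAC.
Qed.

(** Nonsingular trajectories in rhombic coordinates; c ^+ 2 = q times the square
    of the side when c is the speed.  Points of the triangle in the lattice are
    the vertices. *)
Definition coord_traj q g := forall t, [/\ in_tri (g t), ~ lattice (g t) &
  exists v w, [/\ arrives g t v /\ departs g t w, qform v = q /\ qform w = q,
    (forall a, bary a (g t) <> 0) -> w = v
    & forall a, bary a (g t) = 0 -> w = bounce a v]].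

Lemma traj_departs q g t : coord_traj q g -> exists v, departs g t v /\ qform v = q.
Proof. by move=> /(_ t)[_ _ [v [w [[_ ?] [_ ?] _ _]]]]; exists w. Qed.

(** Unfolding without reference to strike times: at each time some element of
    the group carries the position and the velocity to those of the uniform
    motion on the initial line.  A strike multiplies this element by the
    reflection in the side that is struck. *)
Lemma develop q g a v : coord_traj q g -> departs g a v -> forall t, a <= t ->
  exists m c w, [/\ translation c, lin m (g t) + c = g a + (t - a) *: v,
    departs g t w & lin m w = v].
Proof.
move=> tg dv; apply: real_induction.
- exists S1, 0, v; split=> //=; first exact: translation0.
  by rewrite subrr scale0r.
- move=> t ta [m [c [w [tc e dw ew]]]].
  have [d d0 Hd] := departs_nearby dw; exists d => // h hd.
  have [eh dh] := Hd h hd; exists m, c, w; split=> //.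
  by rewrite eh linD linZ ew addrAC e -addrA -scalerDl [t + h - a]addrAC.
- move=> t ta H; have [_ _ [w0 [w [[aw dw] _ hint hbd]]]] := tg t.
  have [d d0 Hd] := arrives_nearby aw.
  (* A time close to t where the motion is already known. *)
  pose h := Num.min d (t - a) / 2.
  have mm : 0 < Num.min d (t - a) by rewrite lt_min d0 subr_gt0.
  have [h0 hd ha] : [/\ 0 < h, h < d & h <= t - a].
    have : Num.min d (t - a) <= d by rewrite ge_min lexx.
    have : Num.min d (t - a) <= t - a by rewrite ge_min lexx orbT.
    by rewrite /h; move: mm; move: (Num.min _ _) => mm *; split; lra.
  have [et dt] := Hd h ltac:(by rewrite h0).
  have [m [c [w1 [tc e dw1 ew1]]]] := H (t - h) ltac:(by apply/andP; split; lra).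
  have ? := departs_uniq dw1 dt; subst w1.
  have et' : lin m (g t) + c = g a + (t - a) *: v.
    rewrite et linD linZ ew1 addrAC e -addrA -scalerDl; congr (_ + _ *: _); lra.
  have [[b hb]|nb] := pselect (exists b, bary b (g t) = 0); last first.
    exists m, c, w; split=> //; rewrite hint // => b hb; apply: nb; by exists b.
  have [k ik hk] := bary_bounce 0 0 hb.
  have [m' em'] := lin_comp (R := R) m (SF b).
  exists m', (lin m (k *: rootv b) + c), w; split=> //.
  + by apply: translationD => //; apply: translation_lin; exact: translation_rootv.
  + rewrite !scale0r !addr0 in hk.
    by rewrite -em' -bounce_lin addrA -linD -hk.
  + by rewrite (hbd b hb) -em' -!bounce_lin bounceK.
Qed.

Lemma develop_weyl q g a v t : coord_traj q g -> departs g a v -> a <= t ->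
  weyl_eq (g t) (g a + (t - a) *: v).
Proof.
move=> tg dv /(develop tg dv)[m [c [w [tc e _ _]]]].
by exists m, c; split.
Qed.

Lemma develop_inv q g a v t w : coord_traj q g -> departs g a v -> departs g t w ->
  rate_sum v = rate_sum w.
Proof.
move=> tg; wlog le : a v t w / a <= t.
  move=> H dv dw; have [at_|/ltW ta] := leP a t; first exact: H dv dw.
  by apply/esym; exact: H dw dv.
move=> dv dw; have [m [c [w' [_ _ dw' <-]]]] := develop tg dv le.
by rewrite rate_sum_lin (departs_uniq dw dw').
Qed.

Lemma traj_qform q g t w : coord_traj q g -> departs g t w -> qform w = q.
Proof.
by move=> tg dw; have [w' [dw' <-]] := traj_departs t tg; rewrite (departs_uniq dw dw').
Qed.

Lemma free_flight q g a b w : coord_traj q g -> departs g a w -> a < b ->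
  (forall t, a < t < b -> forall s, bary s (g t) <> 0) ->
  arrives g b w /\ g b = g a + (b - a) *: w.
Proof.
move=> tg dw ab nostrike.
have step t : a < t -> (forall s, a <= s < t -> g s = g a + (s - a) *: w /\ departs g s w) ->
    arrives g t w /\ g t = g a + (t - a) *: w.
  move=> ta H; have [_ _ [w0 [_ [[aw _] _ _ _]]]] := tg t.
  have [d d0 Hd] := arrives_nearby aw.
  pose h := Num.min d (t - a) / 2.
  have mm : 0 < Num.min d (t - a) by rewrite lt_min d0 subr_gt0.
  have [h0 hd ha] : [/\ 0 < h, h < d & h <= t - a].
    have : Num.min d (t - a) <= d by rewrite ge_min lexx.
    have : Num.min d (t - a) <= t - a by rewrite ge_min lexx orbT.
    by rewrite /h; move: mm; move: (Num.min _ _) => mm *; split; lra.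
  have [et dt] := Hd h ltac:(by rewrite h0).
  have [es ds] := H (t - h) ltac:(by apply/andP; split; lra).
  have ? := departs_uniq ds dt; subst w0; split=> //.
  by rewrite et es -addrA -scalerDl; congr (_ + _ *: _); lra.
have all t : a <= t -> t < b -> g t = g a + (t - a) *: w /\ departs g t w.
  apply: (real_induction (P := fun t => t < b -> g t = g a + (t - a) *: w /\ departs g t w)).
  - by rewrite subrr scale0r addr0.
  - move=> {}t at_ IH; have [tb|bt] := ltP t b; last first.
      by exists 1 => // h h1 tb; exfalso; lra.
    have [et dt] := IH tb; have [d d0 Hd] := departs_nearby dt.
    exists d => // h hd _; have [eh dh] := Hd h hd; split=> //.
    by rewrite eh et -addrA -scalerDl [t + h - a]addrAC.
  - move=> {}t at_ IH tb.
    have [aw et] := step t at_ (fun s hs => IH s hs ltac:(by case/andP: hs => _ /lt_trans; apply)).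
    split=> //; have [_ _ [w0 [w1 [[aw0 dw1] _ hint _]]]] := tg t.
    rewrite (_ : w = w1) //; rewrite hint; last by apply: nostrike; rewrite at_.
    have [d d0 Hd] := arrives_nearby aw; have [d' d'0 Hd'] := arrives_nearby aw0.
    have mm : 0 < Num.min d d' / 2 by rewrite divr_gt0 // lt_min d0.
    have : Num.min d d' / 2 < Num.min d d' by lra.
    rewrite lt_min => /andP[m1 m2].
    have [_ D] := Hd _ (introT andP (conj mm m1)).
    have [_ D'] := Hd' _ (introT andP (conj mm m2)).
    exact: departs_uniq D D'.
by apply: step => // s /andP[]; exact: all.
Qed.

Lemma traj_shift q g t0 : coord_traj q g -> coord_traj q (fun t => g (t0 + t)).
Proof.
move=> tg t; have [h1 h2 [v [w [[a d] hq hi hb]]]] := tg (t0 + t).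
split=> //; exists v, w; split=> //; split.
  by apply: filterS a => h; rewrite addrA.
by apply: filterS d => h; rewrite addrA.
Qed.

Lemma traj_reverse q g : coord_traj q g -> coord_traj q (fun t => g (- t)).
Proof.
move=> tg t; have [h1 h2 [v [w [[a d] [hq hq'] hi hb]]]] := tg (- t).
split=> //; exists (- w), (- v); split; rewrite ?qformN //.
- split.
    by apply: filterS d => h; rewrite opprB addrC scalerN opprK.
  by apply: filterS a => h; rewrite opprD scalerN.
- by move=> /hi ->.
- by move=> b /hb ->; rewrite bounce_lin linN -bounce_lin bounceK.
Qed.

Lemma traj_sym q g m : coord_traj q g -> coord_traj q (fun t => sym m (g t)).
Proof.
move=> tg t; have [h1 h2 [v [w [[a d] [hq hq'] hi hb]]]] := tg t.
have side s : exists s', (bary s (sym m (g t)) = bary s' (g t)) /\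
  (forall z, bounce s (sym_lin m z) = sym_lin m (bounce s' z)).
  by have [s' [? ?]] := sym_side (R := R) m s; exists s'.
have side' s' : exists s, bary s (sym m (g t)) = bary s' (g t).
  exists (match m, s' with
  | S1, _ => s'
  | SR, AD => AX | SR, AX => AY | SR, AY => AD
  | SRR, AY => AX | SRR, AD => AY | SRR, AX => AD
  | SF AX, AX => AX | SF AX, AD => AY | SF AX, AY => AD
  | SF AY, AD => AX | SF AY, AY => AY | SF AY, AX => AD
  | SF AD, AY => AX | SF AD, AX => AY | SF AD, AD => AD
  end).
  by case: m {side} => [|||[]]; case: s' => //=; ring.
split.
- exact: sym_in_tri.
- by move=> /sym_lattice.
- exists (sym_lin m v), (sym_lin m w); split; rewrite ?qform_sym //.
  + split.
      by apply: filterS a => h; rewrite !symE => ->; rewrite sym_linD -scaleNr sym_linZ scaleNr addrAC.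
    by apply: filterS d => h; rewrite !symE => ->; rewrite sym_linD sym_linZ addrAC.
  + move=> H; rewrite hi // => s' hs'; have [s es] := side' s'.
    by apply: (H s); rewrite es.
  + by move=> s; have [s' [-> ->]] := side s => /hb ->.
Qed.

Lemma reach x y t0 : y != 0 -> exists2 t, t0 <= t & x + t * y \is a Num.int.
Proof.
move=> y0; have [yp|yn] := ltP 0 y.
  exists (((Num.ceil (x + t0 * y))%:~R - x) / y).
    by rewrite ler_pdivlMr // lerBrDl ceil_ge.
  by rewrite divfK // addrC subrK intr_int.
have {}yn : y < 0 by rewrite lt_neqAle y0.
exists (((Num.floor (x + t0 * y))%:~R - x) / y).
  by rewrite ler_ndivlMr // lerBlDl floor_le.
by rewrite divfK // addrC subrK intr_int.
Qed.

(** A line contained in a wall meets the vertices on this wall; so a trajectory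
    never slides along a side. *)
Lemma no_slide p v a t0 t1 : v != 0 ->
  (forall t, t0 <= t -> ~ lattice (p + t *: v)) -> wall a (p + t1 *: v) -> ell a v != 0.
Proof.
move=> v0 nl wa; apply/eqP => ev.
have [b ab bv] : exists2 b, a <> b & ell b v != 0.
  case: (a) ev => ev; [exists AY => //|exists AX => //|exists AX => //];
    apply: contraNneq v0 => ev'; apply/eqP; apply: plane_eq;
    by move: ev ev'; rewrite /=; lra.
have [t tt it] := reach (ell b p) t0 bv.
apply: (nl t tt); apply: (two_walls (a := a) (b := b)) => //.
  by move: wa; rewrite /wall !ellD !ellZ ev !mulr0.
by rewrite /wall ellD ellZ.
Qed.

End Trajectories.

(** * Folding a line *)

Section Strikes.
Local Open Scope classical_set_scope.
Local Open Scope ring_scope.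
Context {R : realType}.
Implicit Types (z v w p : plane R) (x y t q e h r : R) (g : R -> plane R).

Lemma inward z d : in_tri z -> (forall b, bary b z = 0 -> 0 <= bary_rate b d) ->
  exists2 e : R, 0 < e & forall h : R, 0 < h < e -> in_tri (z + h *: d).
Proof.
move=> tz hd.
have one b : exists2 e : R, 0 < e & forall h, 0 < h < e -> 0 <= bary b (z + h *: d).
  have [b0|b0] := eqVneq (bary b z) 0.
    exists 1 => // h /andP[h0 _].
    by rewrite bary_rateE b0 add0r mulr_ge0 ?hd // ltW.
  have {b0}bp : 0 < bary b z by rewrite lt_neqAle eq_sym b0 tz.
  exists (bary b z / (`|bary_rate b d| + 1)); first by rewrite divr_gt0 // ltr_wpDl.
  move=> h /andP[h0]; rewrite ltr_pdivlMr ?ltr_wpDl // => hh.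
  rewrite bary_rateE; have : `|h * bary_rate b d| <= bary b z.
    by rewrite normrM gtr0_norm //; lra.
  by rewrite ler_norml => /andP[h1 _]; lra.
have [e1 e10 H1] := one AX; have [e2 e20 H2] := one AY; have [e3 e30 H3] := one AD.
exists (Num.min e1 (Num.min e2 e3)); first by rewrite !lt_min e10 e20.
move=> h; rewrite !lt_min => /and4P[h0 h1 h2 h3].
by case; [apply: H1|apply: H2|apply: H3]; rewrite h0.
Qed.

(** An arbitrary choice, which [fold_unique] makes canonical. *)
Definition fold z : plane R := sval (cid (fold_exists z)).

Lemma foldP z : in_tri (fold z) /\ weyl_eq z (fold z).
Proof. exact: svalP (cid (fold_exists z)). Qed.

Lemma fold_eq z w : in_tri w -> weyl_eq z w -> fold z = w.
Proof.
move=> tw zw; have [tf zf] := foldP z.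
by apply: fold_unique => //; apply: weyl_eq_trans zw; exact: weyl_eq_sym.
Qed.

(** Near a time t the folding map coincides, on either side of t, with an
    element of the group: the one that carries the point at time t to a point of
    the triangle, followed, when this point is on a side and the motion is outside
    the triangle, by the reflection in this side. *)
Lemma fold_traj p v : v != 0 -> (forall t, ~ lattice (p + t *: v)) ->
  coord_traj (qform v) (fun t => fold (p + t *: v)).
Proof.
move=> v0 nl t; set z := fold _.
have [tz wz] := foldP (p + t *: v); rewrite -/z in tz wz.
have nz : ~ lattice z by move=> /(weyl_eq_lattice (weyl_eq_sym wz)) /nl.
split => //.
have [m [c [tc ez]]] := wz; pose d := lin m v.
have step h : weyl_eq (p + (t + h) *: v) (z + h *: d).
  exists m, c; split => //.
  by rewrite ez scalerDl addrA (linD m _ (h *: v)) linZ addrAC.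
have stepb a h : bary a z = 0 -> weyl_eq (p + (t + h) *: v) (z + h *: bounce a d).
  move=> az; have [k ik ->] := bary_bounce h d az.
  by apply: weyl_eq_trans (step h) _; exact: weyl_eq_mirror.
have dep w : (forall h, weyl_eq (p + (t + h) *: v) (z + h *: w)) ->
    (forall b, bary b z = 0 -> 0 <= bary_rate b w) ->
    departs (fun t => fold (p + t *: v)) t w.
  move=> ww hw; have [e e0 He] := inward tz hw.
  by apply/near_rightP; exists e => // h hh; apply: fold_eq => //; exact: He.
have arr w : (forall h, weyl_eq (p + (t + h) *: v) (z + h *: w)) ->
    (forall b, bary b z = 0 -> 0 <= bary_rate b (- w)) ->
    arrives (fun t => fold (p + t *: v)) t w.
  move=> ww hw; have [e e0 He] := inward tz hw.
  apply/near_rightP; exists e => // h hh; apply: fold_eq => //.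
    by rewrite -scalerN; exact: He.
  by rewrite -scaleNr; exact: ww.
have qd : qform d = qform v by rewrite qform_lin.
have rN b w : bary_rate b (- w) = - bary_rate b w.
  by case: b; rewrite /= ?planeE //; ring.
have [[a az]|na] := pselect (exists a, bary a z = 0); last first.
  have na' b : bary b z <> 0 by move=> hb; apply: na; exists b.
  exists d, d; split=> //; first by split; [apply: arr|apply: dep] => // b /na'.
  by move=> b /na'.
have only b : bary b z = 0 -> b = a.
  move=> bz; apply: contrapT => ba; apply: nz.
  by apply: (two_walls (a := b) (b := a)) => //; exact: bary_wall.
have rate0 : bary_rate a d != 0.
  have [b [h1 [h2 _]]] := wall_lin m a tc.1.
  rewrite -normr_eq0 -ell_bary_rate h2 normr_eq0.
  apply: (no_slide (p := p) (t0 := 0) (t1 := t)) => //.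
  by rewrite -h1 -ez; exact: bary_wall.
have qb : qform (bounce a d) = qform v by rewrite bounce_lin qform_lin.
have [rp|rn] := ltP 0 (bary_rate a d).
  exists (bounce a d), d; split=> //.
  - split; last by apply: dep => // b /only ->; rewrite ltW.
    apply: arr => [h|b /only ->]; first exact: stepb.
    by rewrite rN bary_rate_bounce opprK ltW.
  - by move=> /(_ a).
  - by move=> b /only ->; rewrite bounceK.
exists d, (bounce a d); split=> //.
- split; first by apply: arr => // b /only ->; rewrite rN oppr_ge0.
  apply: dep => [h|b /only ->]; first exact: stepb.
  by rewrite bary_rate_bounce oppr_ge0.
- by move=> /(_ a).
- by move=> b /only ->.
Qed.

(** * Counting strikes *)

Lemma card_setU_disjoint (A B : set R) m n : (A #= `I_m)%card -> (B #= `I_n)%card ->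
  (forall t, A t -> B t -> False) -> (A `|` B #= `I_(m + n))%card.
Proof.
move=> Am Bn dAB.
have /finite_fsetP[X eX] : finite_set A by exists m.
have /finite_fsetP[Y eY] : finite_set B by exists n.
move: Am Bn dAB; rewrite {}eX {}eY => /card_eq_fsetP cX /card_eq_fsetP cY dXY.
rewrite -set_fsetU; apply/card_eq_fsetP.
rewrite -cX -cY -cardfsUI (_ : (X `&` Y)%fset = fset0) ?cardfs0 ?addn0 //.
apply/fsetP => t; rewrite in_fsetI in_fset0; apply/negP => /andP[tX tY].
exact: dXY tX tY.
Qed.

(** The times are in arithmetic progression, with first term given by the
    ceiling of the initial value. *)
Lemma card_int_times x r a (N : nat) : r != 0 ->
  ([set t | a <= t < a + N%:R / `|r| /\ x + t * r \is a Num.int] #= `I_N)%card.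
Proof.
wlog r0 : x r / 0 < r.
  move=> H r0; have [rp|rn] := ltP 0 r; first exact: H.
  have {}rn : 0 < - r by rewrite oppr_gt0 lt_neqAle r0.
  have := H (- x) (- r) rn; rewrite oppr_eq0 normrN => /(_ r0).
  by under eq_set => t do rewrite mulrN -opprD rpredN.
move=> _; rewrite gtr0_norm //.
pose k0 := Num.ceil (x + a * r).
pose f (i : nat) := ((k0 + i%:Z)%:~R - x) / r.
have fi : {in `I_N &, injective f}.
  move=> i j _ _ /(congr1 (fun y => y * r)); rewrite /f !divfK ?gt_eqF //.
  by move=> /addIr /intr_inj /addrI [].
have -> : [set t | a <= t < a + N%:R / r /\ x + t * r \is a Num.int] = f @` `I_N.
  apply/seteqP; split=> [t [/andP[at_ ta]] /intrP[k ek]|_ [i iN <-]]; last first.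
    rewrite /f; split; last by rewrite divfK ?gt_eqF // addrC subrK intr_int.
    rewrite ler_pdivlMr // lerBrDl intrD (le_trans (ceil_ge _)) ?lerDl ?ler0n //=.
    rewrite -ltrBlDl -(ltr_pM2r r0) mulrBl !divfK ?gt_eqF //.
    have /andP[+ _] := ceil_itv (x + a * r); rewrite -/k0 intrB => hk0.
    have : i.+1%:R <= N%:R :> R by rewrite ler_nat.
    by rewrite -natr1 -[i%:~R]/(i%:R : R); lra.
  have k0k : k0 <= k by rewrite /k0 ceil_le_int -ek lerD2l ler_pM2r.
  have et : t = (k%:~R - x) / r by rewrite -ek addrAC subrr add0r mulfK ?gt_eqF.
  have ke : k = k0 + `|k - k0|%N%:Z by rewrite gez0_abs ?subr_ge0 // subrKC.
  exists `|k - k0|%N; last by rewrite /f -ke.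
  rewrite /= -ltz_nat gez0_abs ?subr_ge0 // ltrBlDl.
  rewrite -(ltr_int R) -ek intrD.
  have := ceil_ge (x + a * r); rewrite -/k0 => hk0.
  have : t * r < (a + N%:R / r) * r by rewrite ltr_pM2r.
  by rewrite mulrDl divfK ?gt_eqF // -[N%:~R]/(N%:R : R); lra.
exact: inj_card_eq.
Qed.

(** The three families of walls are crossed at different times because two walls
    of different families meet in a vertex. *)
Lemma line_count p v a L (N : axis -> nat) : v != 0 -> 0 < L ->
  (forall t, a <= t -> ~ lattice (p + t *: v)) ->
  (forall b, `|ell b (L *: v)| = (N b)%:R) ->
  ([set t | a <= t < a + L /\ exists b, wall b (p + t *: v)]
     #= `I_(N AX + N AY + N AD))%card.
Proof.
move=> v0 L0 nl hN.
pose S b := [set t | a <= t < a + L /\ wall b (p + t *: v)].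
have cS b : (S b #= `I_(N b))%card.
  have [b0|b0] := eqVneq (ell b v) 0.
    have -> : S b = set0.
      apply/seteqP; split=> // t [_ wt].
      by have := no_slide v0 nl wt; rewrite b0 eqxx.
    have := hN b; rewrite ellZ b0 mulr0 normr0 => /esym/eqP; rewrite pnatr_eq0 => /eqP ->.
    by rewrite II0 card_eq00.
  have eL : L = (N b)%:R / `|ell b v|.
    by rewrite -hN ellZ normrM (gtr0_norm L0) mulfK // normr_eq0.
  rewrite /S; rewrite eL /wall.
  under eq_set => t do rewrite ellD ellZ.
  exact: card_int_times.
have dis b c t : b <> c -> S b t -> S c t -> False.
  move=> bc [/andP[/nl n _] wb] [_ wc]; apply: n.
  exact: two_walls wb wc bc.
rewrite (_ : [set t | _] = (S AX `|` S AY) `|` S AD).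
  apply: card_setU_disjoint => //; first apply: card_setU_disjoint => //.
    by move=> t; exact: dis.
  by move=> t [] tS; exact: dis tS.
apply/seteqP; split=> [t [tL [b wb]]|t [[]|] [tL wb]].
- by case: b wb => wb; [left; left|left; right|right].
- by split=> //; exists AX.
- by split=> //; exists AY.
- by split=> //; exists AD.
Qed.

Lemma line_finite p v a L : v != 0 ->
  (forall t, a <= t -> ~ lattice (p + t *: v)) ->
  finite_set [set t | a <= t < a + L /\ exists b, wall b (p + t *: v)].
Proof.
move=> v0 nl.
pose S b := [set t | a <= t < a + L /\ wall b (p + t *: v)].
have fS b : finite_set (S b).
  have [b0|b0] := eqVneq (ell b v) 0.
    rewrite (_ : S b = set0); first exact: finite_set0.
    apply/seteqP; split=> // t [_ wt].
    by have := no_slide v0 nl wt; rewrite b0 eqxx.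
  pose N := Num.bound `|L * `|ell b v| |.
  have hN : L <= N%:R / `|ell b v|.
    rewrite ler_pdivlMr ?normr_gt0 //.
    by apply: le_trans (ler_norm _) _; apply/ltW/archi_boundP/normr_ge0.
  apply: (@sub_finite_set _ _ _ _ (ex_intro _ N (card_int_times (ell b p) a N b0))).
  move=> t [/andP[at_ ta]]; rewrite /wall ellD ellZ; split=> //.
  by rewrite at_ (lt_le_trans ta) // lerD2l.
apply: (@sub_finite_set _ _ ((S AX `|` S AY) `|` S AD)); last first.
  by rewrite !finite_setU.
move=> t [tL [b wb]].
by case: b wb => wb; [left; left|left; right|right].
Qed.

Lemma strike_wall z w : in_tri z -> ~ lattice z -> weyl_eq z w ->
  (exists b, bary b z = 0) <-> (exists b, wall b w).
Proof.
move=> tz nz zw; split=> [[b bz]|[b wb]].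
  exact: (weyl_eq_wall (weyl_eq_sym zw) (bary_wall bz)).
by have [c wc] := weyl_eq_wall zw wb; exists c; exact: tri_wall.
Qed.

Lemma traj_no_lattice q g a v t : coord_traj q g -> departs g a v -> 0 <= t ->
  ~ lattice (g a + t *: v).
Proof.
move=> tg dv t0 ll; have [_ nl _] := tg (a + t); apply: nl.
have := develop_weyl (t := a + t) tg dv; rewrite lerDl => /(_ t0).
by rewrite addrAC subrr add0r => /weyl_eq_sym /weyl_eq_lattice; exact.
Qed.

Lemma traj_strike q g a v t : coord_traj q g -> departs g a v -> a <= t ->
  (exists b, bary b (g t) = 0) <-> (exists b, wall b (g a + (t - a) *: v)).
Proof.
move=> tg dv at_; have [tz nz _] := tg t.
by apply: strike_wall => //; exact: develop_weyl dv at_.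
Qed.

Lemma card_int_nat (x : R) : x \is a Num.int -> exists N : nat, `|x| = N%:R.
Proof. by move=> /intrP[i ->]; exists `|i|%N; rewrite -intr_norm -abszE. Qed.

(** Strikes are the crossings of walls by the developed line, and the line meets
    no vertex because the trajectory does not. *)
Lemma traj_count q g a v L : 0 < q -> coord_traj q g -> departs g a v -> 0 < L ->
  lattice (L *: v) -> exists2 M : nat, M%:R = rate_sum (L *: v) &
  ([set t | a <= t < a + L /\ exists b, bary b (g t) = 0%R] #= `I_M)%card.
Proof.
move=> q0 tg dv L0 lL.
have [Nx ex] := card_int_nat (lattice_ell AX lL).
have [Ny ey] := card_int_nat (lattice_ell AY lL).
have [Nd ed] := card_int_nat (lattice_ell AD lL).
exists (Nx + Ny + Nd)%N; first by rewrite !natrD -ex -ey -ed.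
have v0 : v != 0.
  by apply: contraTneq q0 => v0; rewrite -(traj_qform tg dv) v0 /qform /= !mulr0 !expr0n /= !addr0 ltxx.
have lineE t : g a + (t - a) *: v = (g a - a *: v) + t *: v.
  by rewrite scalerBl addrA addrAC.
have -> : [set t | a <= t < a + L /\ exists b, bary b (g t) = 0] =
   [set t | a <= t < a + L /\ exists b, wall b ((g a - a *: v) + t *: v)].
  apply/seteqP; split=> t [tL]; have [at_ _] := andP tL;
  by move=> H; split => //; move: H; rewrite -lineE -(traj_strike tg dv at_).
apply: (line_count (N := fun b => match b with AX => Nx | AY => Ny | AD => Nd end)) => //.
  move=> t at_; rewrite -lineE; apply: traj_no_lattice tg dv _.
  by rewrite subr_ge0.
by case; rewrite ?ex ?ey ?ed.
Qed.

End Strikes.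

(** * The placed triangle in coordinates *)

Local Notation edist := Defs.edist.
Local Notation isometry := Defs.isometry.

Section Triangle.
Local Open Scope classical_set_scope.
Local Open Scope ring_scope.
Context {R : realType} (T : triangle R) (hT : placed_equilateral T).
Implicit Types (z v w p d : plane R) (x y t q h r : R) (f g : R -> plane R).

Let s : R := (vC T).1 - (vB T).1.
Let k : R := (vA T).2 - (vB T).2.

Definition vec z : plane R := z.1 *: (vC T - vB T) + z.2 *: (vA T - vB T).
Definition pt z : plane R := vB T + vec z.

Lemma s_gt0 : 0 < s.
Proof. by case: hT => *; rewrite subr_gt0. Qed.

Lemma k_gt0 : 0 < k.
Proof. by case: hT => *; rewrite subr_gt0. Qed.

Lemma edist2 p p' : edist p p' ^+ 2 = (p.1 - p'.1) ^+ 2 + (p.2 - p'.2) ^+ 2.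
Proof.
by rewrite /edist /enorm sqr_sqrtr /dot !planeE -?expr2 // addr_ge0 // sqr_ge0.
Qed.

Lemma frame : [/\ 4 * k ^+ 2 = 3 * s ^+ 2, vC T - vB T = (s, 0) & vA T - vB T = (s / 2, k)].
Proof.
case: hT => /(congr1 (fun x => x ^+ 2)) h1 /(congr1 (fun x => x ^+ 2)) h2 h3 h4 h5.
rewrite !edist2 in h1 h2.
have hA : (vA T).1 - (vB T).1 = s / 2.
  have s0 : s != 0 by rewrite gt_eqF // s_gt0.
  apply: (mulfI s0); rewrite /s; rewrite -h3 in h1 h2; lra.
split; last 2 first.
- by apply: plane_eq; rewrite !planeE //= h3 subrr.
- by apply: plane_eq; rewrite !planeE.
- have : (s / 2) ^+ 2 + k ^+ 2 = s ^+ 2 by rewrite -hA /k /s; rewrite -h3 in h1 h2; lra.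
  by lra.
Qed.

(** In Cartesian coordinates the two sides issued from B are (s, 0) and
    (s / 2, k), by the equality of the three sides. *)
Lemma vecE z : vec z = (s * (z.1 + z.2 / 2), k * z.2).
Proof.
have [_ eu ew] := frame; rewrite /vec eu ew.
by apply: plane_eq; rewrite !planeE /= ?planeE; ring.
Qed.

Lemma dot_vec z w :
  dot (vec z) (vec w) = s ^+ 2 * (z.1 * w.1 + (z.1 * w.2 + z.2 * w.1) / 2 + z.2 * w.2).
Proof.
have [e _ _] := frame; have {}e : k ^+ 2 = 3 / 4 * s ^+ 2 by lra.
rewrite !vecE /dot /=.
rewrite (_ : k * z.2 * (k * w.2) = k ^+ 2 * (z.2 * w.2)); last by ring.
by rewrite e; field.
Qed.

Lemma enorm_vec z : enorm (vec z) = s * Num.sqrt (qform z).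
Proof.
rewrite /enorm dot_vec sqrtrM ?sqr_ge0 // sqrtr_sqr gtr0_norm ?s_gt0 //.
by congr (_ * Num.sqrt _); rewrite /qform; field.
Qed.

Lemma vecD z w : vec (z + w) = vec z + vec w.
Proof. by rewrite /vec; apply: plane_eq; rewrite /= ?planeE /= ?planeE; ring. Qed.

Lemma vecZ t z : vec (t *: z) = t *: vec z.
Proof. by rewrite /vec; apply: plane_eq; rewrite /= ?planeE /= ?planeE; ring. Qed.

Lemma vecN z : vec (- z) = - vec z.
Proof. by rewrite -scaleN1r vecZ scaleN1r. Qed.

Lemma ptD z w : pt (z + w) = pt z + vec w.
Proof. by rewrite /pt vecD addrA. Qed.

Lemma ptB z w : pt z - pt w = vec (z - w).
Proof. by rewrite /pt vecD vecN opprD addrACA subrr add0r. Qed.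

Definition covec p : plane R := (p.1 / s - p.2 / k / 2, p.2 / k).
Definition co p : plane R := covec (p - vB T).

Lemma covecK p : vec (covec p) = p.
Proof.
have s0 := s_gt0; have k0 := k_gt0.
by rewrite vecE /covec; apply: plane_eq; rewrite /=; field; rewrite ?gt_eqF.
Qed.

Lemma vecK z : covec (vec z) = z.
Proof.
have s0 := s_gt0; have k0 := k_gt0.
by rewrite vecE /covec; apply: plane_eq; rewrite /=; field; rewrite ?gt_eqF.
Qed.

Lemma coK p : pt (co p) = p.
Proof. by rewrite /pt covecK addrC subrK. Qed.

Lemma ptK z : co (pt z) = z.
Proof. by rewrite /co /pt addrAC subrr add0r vecK. Qed.

Lemma pt_inj z w : pt z = pt w -> z = w.
Proof. by move=> /(congr1 co); rewrite !ptK. Qed.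

Lemma vec_inj z w : vec z = vec w -> z = w.
Proof. by move=> /(congr1 covec); rewrite !vecK. Qed.

Lemma vBE : vB T = pt 0.
Proof. by rewrite /pt vecE /= !mul0r !addr0 !mulr0 -[(0,0)]/(0 : plane R) addr0. Qed.

Lemma vCE : vC T = pt (1, 0).
Proof. by rewrite /pt /vec /= scale1r scale0r addr0 addrC subrK. Qed.

Lemma vAE : vA T = pt (0, 1).
Proof. by rewrite /pt /vec /= scale1r scale0r add0r addrC subrK. Qed.

Lemma verticesE z : vertices T (pt z) <-> [\/ z = 0, z = (1, 0) | z = (0, 1)].
Proof.
rewrite /vertices vAE vBE vCE; split.
  by move=> [[|]|] /= /pt_inj ->; [apply: Or33|apply: Or31|apply: Or32].
by case=> ->; [left; right|right|left; left].
Qed.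

Lemma vertices_lattice z : in_tri z -> lattice z -> vertices T (pt z).
Proof.
move=> /tri_bounds[h1 h2 h3 h4 h5] [l1 l2]; apply/verticesE.
case: (int_between l1 h1 h3) => e1; case: (int_between l2 h2 h4) => e2.
- by apply: Or31; exact: plane_eq.
- by apply: Or33; exact: plane_eq.
- by apply: Or32; exact: plane_eq.
- by exfalso; lra.
Qed.

Lemma lattice_vertices z : vertices T (pt z) -> lattice z.
Proof. by move=> /verticesE[] ->; split; rewrite /= ?rpred0 ?rpred1. Qed.

Lemma regionE z : region T (pt z) <-> in_tri z.
Proof.
have E a b c : a + b + c = 1 -> a *: vA T + b *: vB T + c *: vC T = pt (c, a).
  move=> h; have -> : b = 1 - a - c by lra.
  by rewrite /pt /vec /=; apply: plane_eq; rewrite !planeE; ring.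
split=> [[a [b [c [a0 b0 c0 h]]]]|/tri_bounds[h1 h2 h3 h4 h5]].
  by rewrite E // => /pt_inj -> []; rewrite /=; lra.
exists z.2, (1 - z.1 - z.2), z.1; split; rewrite ?E ?addrA //; try lra.
Qed.

Definition side a : plane R * plane R :=
  match a with AX => (vA T, vB T) | AY => (vB T, vC T) | AD => (vC T, vA T) end.

Lemma sidesE e : sides T e <-> exists a, e = side a.
Proof.
split; first by move=> [[|]|] /= ->; [exists AX|exists AY|exists AD].
by move=> [[] ->]; [left; left|left; right|right].
Qed.

Lemma segment_pt z w z' : segment (pt z, pt w) (pt z') <->
  exists2 r : R, 0 <= r <= 1 & z' = z + r *: (w - z).
Proof.
have E r : (1 - r) *: pt z + r *: pt w = pt (z + r *: (w - z)).
  by rewrite ptD vecZ -ptB scalerBl scale1r scalerBr addrA [RHS]addrAC.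
split.
  move=> [r /=]; rewrite in_itv /= E => rI /pt_inj <-; by exists r.
by move=> [r rI ->]; exists r; rewrite /= ?in_itv.
Qed.

Lemma segment_side a z : segment (side a) (pt z) <-> in_tri z /\ bary a z = 0.
Proof.
case: a; rewrite /= ?vAE ?vBE ?vCE segment_pt; split.
- move=> [r rI ->]; split; last by rewrite /= ?planeE; ring.
  by case; rewrite /= ?planeE /=; lra.
- move=> [/tri_bounds[h1 h2 h3 h4 h5] e]; exists (1 - z.2); first by lra.
  by apply: plane_eq; rewrite /= ?planeE /=; lra.
- move=> [r rI ->]; split; last by rewrite /= ?planeE; ring.
  by case; rewrite /= ?planeE /=; lra.
- move=> [/tri_bounds[h1 h2 h3 h4 h5] e]; exists (z.1); first by lra.
  by apply: plane_eq; rewrite /= ?planeE /=; lra.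
- move=> [r rI ->]; split; last by rewrite /= ?planeE; ring.
  by case; rewrite /= ?planeE /=; lra.
- move=> [/tri_bounds[h1 h2 h3 h4 h5] e]; exists (z.2); first by lra.
  by apply: plane_eq; rewrite /= ?planeE /=; lra.
Qed.

Lemma boundaryE z : in_tri z -> boundary T (pt z) <-> exists a, bary a z = 0.
Proof.
move=> tz; split.
  by move=> [e /sidesE[a ->] /segment_side[_ za]]; exists a.
by move=> [a za]; exists (side a); [apply/sidesE; exists a|exact/segment_side].
Qed.

Definition dir a : plane R :=
  match a with AX => (0, 1) | AY => (1, 0) | AD => (-1, 1) end.

Lemma mirror_vec_dir e a v : e.2 - e.1 = vec (dir a) \/ e.2 - e.1 = - vec (dir a) ->
  mirror_vec e (vec v) = vec (bounce a v).
Proof.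
have s0 : s != 0 by rewrite gt_eqF ?s_gt0.
have main d : e.2 - e.1 = vec d -> d = dir a \/ d = - dir a ->
    mirror_vec e (vec v) = vec (bounce a v).
  rewrite /mirror_vec => -> hd; rewrite !dot_vec -vecZ -vecN -vecD; congr vec.
  by case: hd => ->; case: a; rewrite /bounce; apply: plane_eq; rewrite /= ?planeE /= ?planeE /=; field.
case=> h; first by apply: (main (dir a)) => //; left.
by apply: (main (- dir a)); [rewrite vecN|right].
Qed.

Lemma mirror_side a v : mirror_vec (side a) (vec v) = vec (bounce a v).
Proof.
apply: mirror_vec_dir; case: a; rewrite /= ?vAE ?vBE ?vCE ptB -?vecN.
- by right; congr vec; apply: plane_eq; rewrite !planeE /=; ring.
- by left; congr vec; apply: plane_eq; rewrite !planeE /=; ring.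
- by left; congr vec; apply: plane_eq; rewrite !planeE /=; ring.
Qed.

Lemma tess_edgeE e : tessellation_edge T e ->
  exists a z, [/\ lattice z, e.1 = pt z & e.2 = pt (z + dir a)].
Proof.
move=> [i [j [e1 e2]]].
have E1 : e.1 = pt (i%:~R, j%:~R) by rewrite e1 /pt /vec /= addrA.
have L : lattice (i%:~R, j%:~R) by split; rewrite /= intr_int.
case: e2 => ->; rewrite E1; [exists AY|exists AX|exists AD];
  exists (i%:~R, j%:~R); split; rewrite // ptD; congr (_ + _); rewrite /vec /=.
- by rewrite scale1r scale0r addr0.
- by rewrite scale1r scale0r add0r.
- by rewrite scale1r scaleN1r addrC.
Qed.

Lemma tess_mirror e z : tessellation_edge T e -> segment e (pt z) ->
  exists2 a, wall a z & forall z', mirror e (pt z') = pt (bounce a z' + ell a z *: rootv a).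
Proof.
move=> /tess_edgeE[a [z0 [lz0 e1 e2]]] sz; exists a.
  move: sz; rewrite [e]surjective_pairing e1 e2 => /segment_pt[r _ ->].
  rewrite /wall ellD ellZ rpredD ?lattice_ell // [z0 + _]addrC addrK.
  by rewrite (_ : ell a _ = 0) ?mulr0 ?rpred0 //; case: (a) => /=; ring.
move=> z'; rewrite /mirror e1 ptB (mirror_vec_dir (a := a)); last first.
  by left; rewrite e1 e2 ptB; congr vec; rewrite addrC addKr.
rewrite -ptD; congr pt.
have -> : ell a z = ell a z0.
  move: sz; rewrite [e]surjective_pairing e1 e2 => /segment_pt[r _ ->].
  rewrite ellD ellZ [z0 + _]addrC addrK.
  by rewrite (_ : ell a (dir a) = 0) ?mulr0 ?addr0 //; case: (a) => /=; ring.
by rewrite /bounce; apply: plane_eq; case: (a); rewrite /= ?planeE /= ?planeE /=; ring.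
Qed.

Lemma tess_exists a z : wall a z -> exists2 e, tessellation_edge T e & segment e (pt z).
Proof.
rewrite /wall => wz.
have key z0 : lattice z0 -> (exists2 r : R, 0 <= r <= 1 & z = z0 + r *: dir a) ->
    exists2 e, tessellation_edge T e & segment e (pt z).
  move=> [/intrP[i ei] /intrP[j ej]] [r rI ez].
  exists (pt z0, pt (z0 + dir a)); last first.
    by apply/segment_pt; exists r; rewrite // ez [z0 + dir a]addrC addrK.
  exists i, j; split; first by rewrite /= /pt /vec ei ej addrA.
  rewrite /= ptD; case: (a).
  - by apply: Or32; rewrite /vec /= scale1r scale0r add0r.
  - by apply: Or31; rewrite /vec /= scale1r scale0r addr0.
  - by apply: Or33; rewrite /vec /= scale1r scaleN1r [- _ + _]addrC.
have fl x := floor_itv x.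
case: a wz key => /= wz key.
- apply: (key (z.1, (Num.floor z.2)%:~R)); first by split; rewrite ?intr_int.
  exists (z.2 - (Num.floor z.2)%:~R).
    by have := fl z.2; rewrite intrD; lra.
  by apply: plane_eq; rewrite /= ?planeE /=; ring.
- apply: (key ((Num.floor z.1)%:~R, z.2)); first by split; rewrite ?intr_int.
  exists (z.1 - (Num.floor z.1)%:~R).
    by have := fl z.1; rewrite intrD; lra.
  by apply: plane_eq; rewrite /= ?planeE /=; ring.
- apply: (key (z.1 + z.2 - (Num.floor z.2)%:~R, (Num.floor z.2)%:~R)).
    by split; rewrite /= ?rpredB ?intr_int.
  exists (z.2 - (Num.floor z.2)%:~R).
    by have := fl z.2; rewrite intrD; lra.
  by apply: plane_eq; rewrite /= ?planeE /=; ring.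
Qed.

Lemma arrives_pt g t v : arrives (pt \o g) t (vec v) <-> arrives g t v.
Proof.
have E h : pt (g t) - h *: vec v = pt (g t - h *: v) by rewrite -vecZ -vecN -ptD.
by split; apply: filterS => h; rewrite /= E; [move/pt_inj|move=> ->].
Qed.

Lemma departs_pt g t v : departs (pt \o g) t (vec v) <-> departs g t v.
Proof.
have E h : pt (g t) + h *: vec v = pt (g t + h *: v) by rewrite -vecZ -ptD.
by split; apply: filterS => h; rewrite /= E; [move/pt_inj|move=> ->].
Qed.

Lemma co_comp f : f = pt \o (co \o f).
Proof. by apply/funext => t /=; rewrite coK. Qed.

Lemma traj_of_coord q g : 0 < q -> coord_traj q g -> nonsingular_trajectory T (pt \o g).
Proof.
move=> q0 tg; exists (s * Num.sqrt q); first by rewrite mulr_gt0 ?s_gt0 ?sqrtr_gt0.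
move=> t; have [h1 h2 [v [w [[a d] [qv qw] hi hb]]]] := tg t.
split; first exact/regionE.
  by move=> /lattice_vertices.
exists (vec v), (vec w); split.
- by split; [exact/arrives_pt|exact/departs_pt].
- by rewrite !enorm_vec qv qw.
- move=> nb; rewrite hi // => b zb; apply: nb; apply/boundaryE => //; by exists b.
- by move=> e /sidesE[b ->] /segment_side[_ /hb ->]; rewrite mirror_side.
Qed.

Lemma coord_of_traj f : nonsingular_trajectory T f ->
  exists2 q, 0 < q & coord_traj q (co \o f).
Proof.
rewrite {1}(co_comp f); move: (co \o f) => g [c c0 H].
exists ((c / s) ^+ 2); first by rewrite exprn_gt0 // divr_gt0 ?s_gt0.
move=> t; have [/regionE h1 h2 [v [w [[a d] [nv nw] hi hb]]]] := H t.
have qc v' : enorm v' = c -> qform (covec v') = (c / s) ^+ 2.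
  rewrite -{1}(covecK v') enorm_vec => <-; rewrite mulrAC divff ?mul1r.
    by rewrite sqr_sqrtr // /qform; nra.
  by rewrite gt_eqF ?s_gt0.
split=> //; first by move=> l; apply: h2; exact: vertices_lattice.
exists (covec v), (covec w); split.
- by split; [apply/arrives_pt; rewrite covecK|apply/departs_pt; rewrite covecK].
- by split; exact: qc.
- by move=> H'; rewrite hi // => /boundaryE -/(_ h1)[b] /H'.
- move=> b zb; apply: vec_inj; rewrite -mirror_side !covecK; apply: hb.
    by apply/sidesE; exists b.
  by apply/segment_side.
Qed.

Lemma edist_pt z w : edist (pt z) (pt w) = s * Num.sqrt (qform (z - w)).
Proof. by rewrite /edist ptB enorm_vec. Qed.

Lemma qform_ge0 z : 0 <= qform z.
Proof. by rewrite /qform; nra. Qed.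

Lemma edist_pt_eq z w z' w' : edist (pt z) (pt w) = edist (pt z') (pt w') <->
  qform (z - w) = qform (z' - w').
Proof.
rewrite !edist_pt; split=> [|-> //].
move=> /mulfI => /(_ (ltac:(by rewrite gt_eqF ?s_gt0))) /eqP.
by rewrite eqr_sqrt ?qform_ge0 // => /eqP.
Qed.

Lemma sym_isometry m : isometry (pt \o sym m \o co) /\
  (pt \o sym m \o co) @` vertices T = vertices T.
Proof.
split.
  move=> p p'; rewrite -{2}(coK p) -{2}(coK p') /=; apply/edist_pt_eq.
  rewrite !symE opprD addrACA subrr addr0 -[- sym_lin m _]scaleN1r -sym_linZ -sym_linD.
  by rewrite qform_sym scaleN1r.
have V m' z : [\/ z = 0, z = (1, 0) | z = (0, 1)] ->
    [\/ sym m' z = 0, sym m' z = (1, 0) | sym m' z = (0, 1)].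
  by case: m' => [|||[]]; case=> ->; rewrite /sym /= ?subr0 ?subrr;
    do ?[by apply: Or31; apply: plane_eq|by apply: Or32|by apply: Or33].
have S : exists m', forall z, sym m (sym m' z) = z.
  exists (match m with SR => SRR | SRR => SR | _ => m end) => z.
  by case: m => [|||[]]; apply: plane_eq; rewrite /=; ring.
apply/seteqP; split=> [_ [p + <-]|p].
  by rewrite -{1}(coK p) => /verticesE/V h /=; apply/verticesE.
have [m' mK] := S.
rewrite -{1}(coK p) => /verticesE/(V m')/verticesE h; exists (pt (sym m' (co p))) => //.
by rewrite /= ptK mK coK.
Qed.

(** Trilateration: the distances of a point to the three vertices determine it,
    so that an isometry is determined by the images of the vertices. *)
Lemma isometry_sym (phi : plane R -> plane R) : isometry phi ->
  phi @` vertices T = vertices T -> exists m, forall z, phi (pt z) = pt (sym m z).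
Proof.
move=> iphi vphi.
have im z : [\/ z = 0, z = (1, 0) | z = (0, 1)] ->
    exists2 z', phi (pt z) = pt z' & [\/ z' = 0, z' = (1, 0) | z' = (0, 1)].
  move=> /verticesE vz; exists (co (phi (pt z))); first by rewrite coK.
  by apply/verticesE; rewrite coK -vphi; exists (pt z).
have [b eb hb] := im 0 (Or31 _ _ erefl).
have [c ec hc] := im (1, 0) (Or32 _ _ erefl).
have [a ea ha] := im (0, 1) (Or33 _ _ erefl).
have dphi z w : qform (co (phi (pt z)) - co (phi (pt w))) = qform (z - w).
  by apply/edist_pt_eq; rewrite !coK iphi.
have ceq z z' : phi (pt z) = pt z' -> co (phi (pt z)) = z' by move=> ->; rewrite ptK.
have := dphi 0 (1, 0); have := dphi 0 (0, 1); have := dphi (1, 0) (0, 1).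
rewrite (ceq _ _ eb) (ceq _ _ ec) (ceq _ _ ea) => d3 d2 d1.
have fin m : sym m 0 = b -> sym m (1, 0) = c -> sym m (0, 1) = a ->
    forall z, phi (pt z) = pt (sym m z).
  move=> mb mc ma z; rewrite -[phi _]coK; congr pt.
  have := dphi z 0; have := dphi z (1, 0); have := dphi z (0, 1).
  rewrite (ceq _ _ eb) (ceq _ _ ec) (ceq _ _ ea) -mb -mc -ma.
  move: (co _) => w; rewrite /qform !planeE; clear vphi im eb ec ea dphi ceq d1 d2 d3.
  case: (m) => [|||[]] /= h1 h2 h3; apply: plane_eq; rewrite /=; lra.
move: d1 d2 d3 fin; rewrite /qform !planeE; clear vphi im eb ec ea dphi ceq.
case: hb => ->; case: hc => ->; case: ha => -> /= d1 d2 d3 fin; try (exfalso; lra).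
- by exists S1; apply: fin; apply: plane_eq; rewrite /=; ring.
- by exists (SF AD); apply: fin; apply: plane_eq; rewrite /=; ring.
- by exists (SF AY); apply: fin; apply: plane_eq; rewrite /=; ring.
- by exists SR; apply: fin; apply: plane_eq; rewrite /=; ring.
- by exists SRR; apply: fin; apply: plane_eq; rewrite /=; ring.
- by exists (SF AX); apply: fin; apply: plane_eq; rewrite /=; ring.
Qed.

(** The triple angle formula at pi / 3 is a cubic equation whose only positive
    root is 1 / 2. *)
Lemma cos_pi3 : cos (pi / 3 : R) = 1 / 2.
Proof.
have p0 := pi_gt0 R.
have c0 : 0 < cos (pi / 3 : R) by apply: cos_gt0_pihalf; lra.
have : cos (pi / 3 *+ 2 + pi / 3 : R) = -1.
  by rewrite (_ : _ + _ = pi) ?cospi // -mulr_natl; field.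
rewrite cosD cos_mulr2n sin_mulr2n -[cos _ * sin _ *+ 2]mulr_natl -mulr_natl.
rewrite -!mulrA -expr2 sin2cos2; move: (cos _) c0 => c c0 e.
have : (c + 1) * (2 * c - 1) ^+ 2 = 0 by lra.
by move/eqP; rewrite mulf_eq0 sqrf_eq0 => /orP[]/eqP; lra.
Qed.

Lemma cos_pi6 : 0 < cos (pi / 6 : R) /\ cos (pi / 6 : R) ^+ 2 = 3 / 4.
Proof.
have p0 := pi_gt0 R.
split; first by apply: cos_gt0_pihalf; lra.
have := cos_pi3; rewrite (_ : pi / 3 = pi / 6 *+ 2); last by rewrite -mulr_natl; field.
by rewrite cos_mulr2n -mulr_natl; lra.
Qed.

(** With s the side, the velocity has horizontal component s (x + y / 2) and
    norm s sqrt q.  The bounds 1 / 2 and sqrt 3 / 2 on the cosine of its angle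
    become 0 <= x (x + y) and 0 <= (y - x) (x + 2 y), where both second factors are
    positive. *)
Lemma angle_cone v : 0 < (vec v).1 -> 0 < (vec v).2 ->
  (pi / 6 <= line_angle (vec v) (vC T - vB T) <= pi / 3 <-> cone v).
Proof.
have s0 := s_gt0; have k0 := k_gt0; have p0 := pi_gt0 R.
have eV := vecE v; rewrite {1 2}eV /= !pmulr_rgt0 // => v1 v2.
have q0 : 0 < qform v by rewrite /qform; nra.
pose x := (v.1 + v.2 / 2) / Num.sqrt (qform v).
have sq0 : 0 < Num.sqrt (qform v) by rewrite sqrtr_gt0.
have x0 : 0 < x by rewrite divr_gt0.
have x0' := ltW x0.
have xE : x ^+ 2 * qform v = (v.1 + v.2 / 2) ^+ 2.
  by rewrite /x expr_div_n sqr_sqrtr ?ltW // divfK // gt_eqF.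
have x1 : x <= 1.
  by rewrite -(ler_pXn2r (n := 2)) ?nnegrE // expr1n -(ler_pM2r q0) xE mul1r /qform; nra.
have -> : line_angle (vec v) (vC T - vB T) = acos x.
  rewrite /line_angle; congr acos.
  have -> : vC T - vB T = vec (1, 0) by rewrite /vec /= scale1r scale0r addr0.
  rewrite dot_vec !enorm_vec {2}/qform /= !(mulr0, mulr1, addr0, expr1n, expr0n) /= ?addr0 ?add0r.
  rewrite sqrtr1 mulr1 gtr0_norm ?mulr_gt0 ?exprn_gt0 // /x.
  by field; rewrite !gt_eqF.
have xI : x \in `[-1, 1] by rewrite in_itv /=; lra.
have aI : acos x \in `[0, pi].
  by rewrite in_itv /= acos_ge0 ?acos_lepi //; lra.
have mono y : y \in `[0, pi] -> ((y <= acos x) = (x <= cos y)) * ((acos x <= y) = (cos y <= x)).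
  move=> yI; rewrite -{2 4}(acosK xI).
  by split; rewrite leNgt [RHS]leNgt ltr_cos.
have I6 : (pi / 6 : R) \in `[0, pi] by rewrite in_itv /=; lra.
have I3 : (pi / 3 : R) \in `[0, pi] by rewrite in_itv /=; lra.
rewrite !mono // cos_pi3; have [c0 c2] := cos_pi6; have c0' := ltW c0.
have E1 : (x <= cos (pi / 6)) = ((v.1 + v.2 / 2) ^+ 2 <= 3 / 4 * qform v).
  by rewrite -(ler_pXn2r (n := 2)) ?nnegrE // c2 -(ler_pM2r q0) xE.
have E2 : (1 / 2 <= x) = (1 / 4 * qform v <= (v.1 + v.2 / 2) ^+ 2).
  rewrite -(ler_pXn2r (n := 2)) ?nnegrE // -(ler_pM2r q0) xE.
  by congr (_ * _ <= _); field.
rewrite E1 E2 /cone /qform; split=> [/andP[h1 h2]|/andP[h1 h2]]; last first.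
  by apply/andP; split; nra.
have h3 : 0 < v.1 + v.2 by lra.
have h4 : 0 < v.1 + 2 * v.2 by lra.
have a1 : 0 <= v.1 * (v.1 + v.2) by lra.
have a2 : 0 <= (v.2 - v.1) * (v.1 + 2 * v.2) by lra.
rewrite pmulr_lge0 // in a1; rewrite pmulr_lge0 // in a2.
by rewrite a1; lra.
Qed.

Lemma cone_dir v : cone v -> v != 0 -> 0 < (vec v).1 /\ 0 < (vec v).2.
Proof.
have s0 := s_gt0; have k0 := k_gt0.
move=> /andP[h1 h2] v0; have : 0 < v.2.
  rewrite lt_neqAle (le_trans h1) // andbT eq_sym; apply: contraNneq v0 => e.
  by apply/eqP/plane_eq; rewrite /=; lra.
by move=> h; rewrite vecE /= !pmulr_rgt0 //; split=> //; lra.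
Qed.

End Triangle.

(** * Unfoldings and periods *)

Section Unfolding.
Local Open Scope classical_set_scope.
Local Open Scope ring_scope.
Context {R : realType} (T : triangle R) (hT : placed_equilateral T).
Implicit Types (z v w p : plane R) (x y t q h r : R) (f g : R -> plane R).

Lemma arrives_uniq g t v w : arrives g t v -> arrives g t w -> v = w.
Proof.
move=> /arrives_nearby[d d0 Hd] /arrives_nearby[d' d'0 Hd'].
have mm : 0 < Num.min d d' / 2 by rewrite divr_gt0 // lt_min d0.
have : Num.min d d' / 2 < Num.min d d' by lra.
rewrite lt_min => /andP[m1 m2].
have [_ D] := Hd _ (introT andP (conj mm m1)).
have [_ D'] := Hd' _ (introT andP (conj mm m2)).
exact: departs_uniq D D'.
Qed.

Lemma bounce_wall a z : bounce a z + ell a z *: rootv a = z.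
Proof. by rewrite /bounce subrK. Qed.

(** The composite of reflections in the edges met so far is an element of the
    group that carries the i-th flight to the developed line.  Whatever edge
    contains the next point of the line, it lies on the only wall through this
    point, which is the image of the side that is struck. *)
Lemma unfold_step q g v (m : nat) (tau : nat -> R) (s : nat -> plane R * plane R) :
  coord_traj q g -> departs g 0 v -> tau 0%N = 0 ->
  (forall i, (i < m)%N -> tau i < tau i.+1) ->
  (forall i, (i < m)%N -> forall t, tau i < t < tau i.+1 ->
     forall b, bary b (g t) <> 0) ->
  (forall i, (i.+1 < m)%N -> exists b, bary b (g (tau i.+1)) = 0) ->
  (forall i, (i.+1 < m)%N ->
     unfolding_map s i (pt T (g (tau i.+1))) = pt T (g 0 + tau i.+1 *: v) ->
     tessellation_edge T (s i) /\ segment (s i) (pt T (g 0 + tau i.+1 *: v))) ->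
  forall i, (i < m)%N ->
    unfolding_map s i (pt T (g (tau i.+1))) = pt T (g 0 + tau i.+1 *: v).
Proof.
move=> tg dv tau0 taui free strike hs.
pose ok i := exists M c w, [/\ translation c,
   forall z, unfolding_map s i (pt T z) = pt T (lin M z + c),
   lin M (g (tau i)) + c = g 0 + tau i *: v, departs g (tau i) w & lin M w = v].
have fly i : (i < m)%N -> forall M c w,
   lin M (g (tau i)) + c = g 0 + tau i *: v -> departs g (tau i) w -> lin M w = v ->
   arrives g (tau i.+1) w /\ lin M (g (tau i.+1)) + c = g 0 + tau i.+1 *: v.
  move=> im M c w e dw ew.
  have [aw ->] := free_flight tg dw (taui i im) (free i im); split=> //.
  rewrite linD linZ ew addrAC e -addrA -scalerDl; congr (_ + _ *: _).
  by rewrite addrC subrK.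
have okP i : ok i -> (i < m)%N ->
    unfolding_map s i (pt T (g (tau i.+1))) = pt T (g 0 + tau i.+1 *: v).
  move=> [M [c [w [tc U e dw ew]]]] im.
  by rewrite U; have [_ ->] := fly i im M c w e dw ew.
suff H i : (i < m)%N -> ok i by move=> i im; apply: okP => //; exact: H.
elim: i => [_|i IH im].
  exists S1, 0, v; rewrite tau0; split=> //=; first exact: translation0.
    by move=> z; rewrite addr0.
  by rewrite scale0r.
have im' := ltnW im; have oki := IH im'.
have [se sseg] := hs i im (okP i oki im').
have [M [c [w [tc U e dw ew]]]] := oki.
have [aw ey] := fly i im' M c w e dw ew.
have [a wa mE] := tess_mirror hT se sseg.
have [b yb] := strike i im.
have [_ ny [v0 [w' [[av0 dw'] _ _ /(_ b yb) ew']]]] := tg (tau i.+1).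
have [b' [h1 [_ h2]]] := wall_lin M a tc.1.
have eb : b' = b.
  apply: contrapT => bb; apply: ny; apply: (two_walls (a := b') (b := b)) => //.
    by rewrite -h1 ey.
  exact: bary_wall.
have [M' eM'] := lin_comp (R := R) (SF a) M.
pose z := g 0 + tau i.+1 *: v.
exists M', (bounce a c + ell a z *: rootv a), w'; split => //.
- by apply: translationD; [rewrite bounce_lin; exact: translation_lin|exact: translation_rootv].
- by move=> z'; rewrite /= U mE -eM' addrA -!bounce_lin !bounce_lin -linD.
- by rewrite -eM' -/z addrA -bounce_lin !bounce_lin -linD ey -/z -bounce_lin bounce_wall.
- by rewrite -eM' -bounce_lin h2 eb ew' (arrives_uniq av0 aw) bounceK.
Qed.

(** The quotient of the lattice by the translations has order three. *)
Lemma translation_half z : translation (2 *: z) -> lattice z -> translation z.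
Proof.
move=> [_ h] [l1 l2]; split=> //.
rewrite (_ : _ / 3 = (z.1 - z.2) - ((2 *: z).1 - (2 *: z).2) / 3).
  by rewrite rpredB // rpredB.
by rewrite !planeE; field.
Qed.

(** One period gives an element of the group that translates the developed line
    along itself.  Its linear part fixes the direction of motion, hence is the
    identity or a reflection; in the second case the direction is that of a
    family of walls, and the square of the element is a translation. *)
Lemma period_translation q g a v L : 0 < q -> coord_traj q g -> departs g a v -> 0 < L ->
  (forall t, g (t + L) = g t) ->
  translation (2 *: (L *: v)) /\ (translation (L *: v) \/ exists b, ell b v = 0).
Proof.
move=> q0 tg dv L0 per.
have [m [c [w [tc e dw ew]]]] := develop tg dv (t := a + L) (ltac:(by rewrite lerDl ltW)).
have dw' : departs g a w.
  by apply: filterS dw => h; rewrite [a + L + h]addrAC !per.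
have ? := departs_uniq dv dw'; subst w.
rewrite per [a + L - a]addrAC subrr add0r in e.
have v0 : v <> 0.
  by move=> v0; move: q0; rewrite -(traj_qform tg dv) v0 /qform /= !mulr0 !expr0n /= !addr0 ltxx.
case: m e ew => [|||b] e ew.
- have -> : L *: v = c by apply: (addrI (g a)); rewrite -e.
  by split; [rewrite scaler_nat mulr2n; exact: translationD|left].
- case: v0; move: (congr1 fst ew) (congr1 snd ew) => /= h1 h2.
  by apply: plane_eq; rewrite /=; lra.
- case: v0; move: (congr1 fst ew) (congr1 snd ew) => /= h1 h2.
  by apply: plane_eq; rewrite /=; lra.
- split; last first.
    right; exists b; move: ew; rewrite -bounce_lin /bounce => /(congr1 (ell b)).
    rewrite -scaleNr ellD ellZ.
    have -> : ell b (rootv b : plane R) = 2 by case: (b) => /=; ring.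
    by lra.
  have -> : 2 *: (L *: v) = lin (SF b) c + c.
    apply: (addrI (g a)).
    have -> : 2 *: (L *: v) = L *: v + L *: v by rewrite scaler_nat mulr2n.
    have h : g a + lin (SF b) c = lin (SF b) (g a) + L *: v.
      by rewrite -{1}ew -linZ -linD -e linD -!bounce_lin bounceK.
    by rewrite !addrA h addrAC e.
  by apply: translationD => //; exact: translation_lin.
Qed.

(** Counting over two periods, where the displacement is a translation, gives
    the value of rate_sum in all cases.  For a glide reflection, one family of
    walls is not crossed, so each coordinate of the displacement over one period
    is 0, n or -n; it is an integer because the number of strikes is even. *)
Lemma period_lattice q g a v L (n : nat) : 0 < q -> coord_traj q g -> departs g a v ->
  0 < L -> (forall t, g (t + L) = g t) ->
  ([set t | a <= t < a + L /\ exists b, bary b (g t) = 0%R] #= `I_(2 * n))%card ->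
  translation (L *: v) /\ rate_sum (L *: v) = (2 * n)%:R.
Proof.
move=> q0 tg dv L0 per cn.
have [t2 tb] := period_translation q0 tg dv L0 per.
have L2 : 0 < 2 * L by rewrite mulr_gt0.
have := traj_count q0 tg dv L2; rewrite -scalerA => /(_ t2.1)[M eM cM].
pose A := [set t | a <= t < a + L /\ exists b, bary b (g t) = 0%R].
have cA' : ((fun t => t + L) @` A #= `I_(2 * n))%card.
  apply: card_eq_trans cn; apply: inj_card_eq => t t' _ _; exact: addIr.
have := card_setU_disjoint cn cA'.
have dis t : A t -> [set x + L | x in A] t -> False.
  by move=> [/andP[_ h1] _] [t' [/andP[h2 _] _] e]; lra.
move=> /(_ dis).
have -> : A `|` [set x + L | x in A] =
   [set t | a <= t < a + 2 * L /\ exists b, bary b (g t) = 0%R].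
  apply/seteqP; split=> t.
    move=> [[/andP[h1 h2] h]|[t' [/andP[h1 h2] [b hb]] <-]].
      by split=> //; apply/andP; split; lra.
    by split; [apply/andP; split; lra|exists b; rewrite per].
  move=> [/andP[h1 h2] [b hb]]; have [tL|Lt] := ltP t (a + L).
    by left; split; [rewrite h1|exists b].
  right; exists (t - L); last by rewrite subrK.
  split; first by apply/andP; split; lra.
  by exists b; rewrite -per subrK.
move=> c2; have /card_eq_II eMn := card_eq_trans (card_esym c2) cM.
have rn : rate_sum (L *: v) = (2 * n)%:R.
  by move: eM; rewrite -eMn rate_sumZ normr_nat natrD; lra.
split=> //; case: tb => [//|[b hb]].
apply: translation_half => //.
have hL : ell b (L *: v) = 0 by rewrite ellZ hb mulr0.
have key x : `|x| = n%:R -> x \is a Num.int by move=> e; rewrite -int_norm e rpred_nat.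
move: rn hL; rewrite /rate_sum natrM; move: (L *: v) => z; case: (b) => /= rn e.
- move: rn; rewrite e normr0 !add0r => rn; split; first by rewrite e rpred0.
  by apply: key; lra.
- move: rn; rewrite e normr0 !addr0 => rn; split; last by rewrite e rpred0.
  by apply: key; lra.
- have e2 : z.2 = - z.1 by lra.
  move: rn; rewrite e normr0 e2 normrN addr0 => rn.
  have i1 : z.1 \is a Num.int by apply: key; lra.
  by split; rewrite ?e2 ?rpredN.
Qed.

(** The representative of z in the cone has coordinates (x, x + 3d). *)
Lemma lattice_type z (n : nat) : translation z -> rate_sum z = (2 * n)%:R ->
  exists x d : nat, n = (2 * x + 3 * d)%N /\
    qform z = qform (x%:R, (x + 3 * d)%:R) :> R.
Proof.
move=> tz rz.
have main w : translation w -> cone w -> rate_sum w = rate_sum z -> qform w = qform z ->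
    exists x d : nat, n = (2 * x + 3 * d)%N /\ qform z = qform (x%:R, (x + 3 * d)%:R) :> R.
  move=> [[i1 i2] i3] cw rw qw; have /andP[c1 c2] := cw.
  have nat_of x : x \is a Num.int -> 0 <= x -> exists N : nat, x = N%:R.
    by move=> /card_int_nat[N eN] x0; exists N; rewrite -eN ger0_norm.
  have [x ex] := nat_of _ i1 c1.
  have [d ed] : exists N : nat, (w.2 - w.1) / 3 = N%:R.
    apply: nat_of; last by lra.
    by rewrite -opprB mulNr rpredN.
  have ey : w.2 = (x + 3 * d)%:R by rewrite natrD natrM; lra.
  exists x, d; split; last by rewrite -qw; congr qform; apply: plane_eq.
  have := rate_sum_cone cw; rewrite rw rz ex ey -natrD -natrM => /eqP.
  by rewrite eqr_nat => /eqP; lia.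
have [m [cz|cz]] := to_cone z.
  by apply: (main (lin m z)) => //; rewrite ?rate_sum_lin ?qform_lin //; exact: translation_lin.
apply: (main (- lin m z)) => //; rewrite ?rate_sumN ?qformN ?rate_sum_lin ?qform_lin //.
exact/translationN/translation_lin.
Qed.

(** Together with qform, the invariant that survives strikes, symmetries of the
    triangle and reversal of time, and which therefore determines the direction
    in the cone. *)
Definition has_rate g r := forall t w, departs g t w -> rate_sum w = r.

Lemma traj_has_rate q g a v : coord_traj q g -> departs g a v -> has_rate g (rate_sum v).
Proof. by move=> tg dv t w dw; rewrite (develop_inv tg dv dw). Qed.

Lemma has_rate_shift g r t0 : has_rate g r -> has_rate (fun t => g (t0 + t)) r.
Proof.
by move=> hg t w dw; apply: (hg (t0 + t)); apply: filterS dw => h; rewrite addrA.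
Qed.

Lemma has_rate_reverse q g r : coord_traj q g -> has_rate g r ->
  has_rate (fun t => g (- t)) r.
Proof.
move=> tg hg t w dw; have [_ _ [v [_ [[av _] _ _ _]]]] := tg (- t).
have dv : departs (fun t => g (- t)) t (- v).
  by apply: filterS av => h; rewrite opprD scalerN.
rewrite (departs_uniq dw dv) rate_sumN.
have [d d0 Hd] := arrives_nearby av.
have [_ dd] := Hd (d / 2) (ltac:(by apply/andP; split; lra)).
exact: hg dd.
Qed.

Lemma has_rate_sym q g r m : coord_traj q g -> has_rate g r ->
  has_rate (fun t => sym m (g t)) r.
Proof.
move=> tg hg t w dw; have [v [dv _]] := traj_departs t tg.
have dv' : departs (fun t => sym m (g t)) t (sym_lin m v).
  by apply: filterS dv => h; rewrite !symE => ->; rewrite sym_linD sym_linZ addrAC.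
by rewrite (departs_uniq dw dv') rate_sum_sym; exact: hg dv.
Qed.

Lemma periodic_coord o : periodic_orbit T o -> exists2 q, 0 < q &
  [/\ coord_traj q (co T \o curve o), 0 < finish o - start o
    & forall t, (co T \o curve o) (t + (finish o - start o)) = (co T \o curve o) t].
Proof.
move=> [nt sf per]; have [q q0 tg] := coord_of_traj hT nt.
exists q => //; split=> //; first by rewrite subr_gt0.
move=> t /=; congr co; have := per (t - start o).
by rewrite subrKC => ->; congr curve; ring.
Qed.

Lemma repositioned_coord q o f : coord_traj q (co T \o curve o) -> repositioned T o f ->
  exists2 g, f = pt T \o g & coord_traj q g /\
    forall r, has_rate (co T \o curve o) r -> has_rate g r.
Proof.
move=> tg [phi [t0 [rev [iphi vphi ef]]]].
have [m mE] := isometry_sym hT iphi vphi.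
set c := co T \o curve o in tg *.
exists (fun t => sym m (c (t0 + (-1) ^+ rev * t))).
  by apply/funext => t; rewrite ef /= -mE /c /= coK.
case: rev {ef} => /=.
  have -> : (fun t => sym m (c (t0 + (-1) ^+ 1 * t))) =
            (fun t => sym m ((fun t => (fun t => c (t0 + t)) (- t)) t)).
    by apply/funext => t; rewrite expr1 mulN1r.
  have ts := traj_shift t0 tg; have tr := traj_reverse ts.
  split; first exact: traj_sym tr.
  move=> r hr; apply: has_rate_sym tr _; apply: has_rate_reverse ts _.
  exact: has_rate_shift.
have -> : (fun t => sym m (c (t0 + (-1) ^+ 0 * t))) =
          (fun t => sym m ((fun t => c (t0 + t)) t)).
  by apply/funext => t; rewrite expr0 mul1r.
have ts := traj_shift t0 tg.
split; first exact: traj_sym ts.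
move=> r hr; apply: has_rate_sym ts _.
exact: has_rate_shift.
Qed.

Lemma tau_mono (m : nat) (tau : nat -> R) :
  (forall i, (i < m)%N -> tau i < tau i.+1) ->
  forall i j, (i < j <= m)%N -> tau i < tau j.
Proof.
move=> H i; elim=> [|j IH]; first by rewrite ltn0.
rewrite ltnS => /andP[ij jm]; apply: le_lt_trans (H j jm).
move: ij; rewrite leq_eqVlt => /predU1P[-> //|ij].
by apply/ltW/IH; rewrite ij ltnW.
Qed.

Lemma strike_times q g L (m : nat) (tau : nat -> R) :
  coord_traj q g ->
  (forall i, (i < m)%N -> tau i < tau i.+1) ->
  tau @` [set i | (i <= m)%N] = [set t | 0 <= t <= L /\ boundary T (pt T (g t))] ->
  (forall i, (i < m)%N -> forall t, tau i < t < tau i.+1 -> forall b, bary b (g t) <> 0) /\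
  (forall i, (i <= m)%N -> exists b, bary b (g (tau i)) = 0).
Proof.
move=> tg taui img; have mono := tau_mono taui.
have im i : (i <= m)%N -> 0 <= tau i <= L /\ boundary T (pt T (g (tau i))).
  by move=> im; have : (tau @` [set i | (i <= m)%N]) (tau i) by [exists i]; rewrite img.
split=> [i lim t /andP[h1 h2] b bt|i /im[_ /boundaryE]]; last first.
  by apply=> //; have [] := tg (tau i).
have [/andP[a1 _] _] := im i (ltnW lim); have [/andP[_ a2] _] := im i.+1 lim.
have [tt _ _] := tg t.
have : (tau @` [set i | (i <= m)%N]) t.
  rewrite img; split; first by apply/andP; split; lra.
  by apply/boundaryE => //; exists b.
move=> [j jm ej]; rewrite -{}ej in h1 h2.
have [ji|ij] := leqP j i.
  move: ji; rewrite leq_eqVlt => /predU1P[e|ji]; first by rewrite e ltxx in h1.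
  have := mono j i; rewrite ji (ltnW lim) => /(_ isT); lra.
move: ij; rewrite leq_eqVlt => /predU1P[e|ij]; first by rewrite -e ltxx in h2.
have := mono i.+1 j; rewrite ij jm => /(_ isT); lra.
Qed.

(** The displacement of an unfolding is in the cone by the angle condition, so
    that its two invariants determine it. *)
Lemma unfolding_vector q o v P Q : periodic_orbit T o -> coord_traj q (co T \o curve o) ->
  departs (co T \o curve o) (start o) v -> is_unfolding T o P Q ->
  exists2 V, Q = P + vec T V & [/\ P.2 = (vB T).2, cone V,
    rate_sum V = rate_sum ((finish o - start o) *: v)
    & qform V = qform ((finish o - start o) *: v)].
Proof.
move=> po tg dv [f [m [tau [s [rf [eP sP [v1 [dv1 v11 v12 ang]]] [tau0 taum taui img] hs eQ]]]]].
have [q' q'0 [tg' L0 per]] := periodic_coord po.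
have [g ef [tgg hr]] := repositioned_coord tg rf.
set L := finish o - start o in L0 taum img eQ *.
have ev1 : v1 = vec T (covec T v1) by rewrite covecK.
move: dv1 v11 v12 ang; rewrite {}ev1; move: (covec T v1) => {}v1 dv1 v11 v12 ang.
have cv1 : cone v1 by apply/(angle_cone hT v11 v12).
rewrite ef in dv1; move/departs_pt: dv1 => /(_ hT) dv1.
have rv1 : rate_sum v1 = rate_sum v by apply: hr dv1; exact: traj_has_rate dv.
have qv1 : qform v1 = qform v by rewrite (traj_qform tgg dv1) (traj_qform tg dv).
rewrite ef /= in eP sP img hs eQ.
have [free strike] := strike_times tgg taui img.
have m0 : (0 < m)%N by case: (m) taum => // e; move: L0; rewrite -e tau0 ltxx.
have hstep i : (i.+1 < m)%N -> exists b, bary b (g (tau i.+1)) = 0.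
  by move=> im; apply: strike; exact: ltnW.
have := unfold_step tgg dv1 tau0 taui free hstep.
move=> /(_ s) H.
have hs' i : (i.+1 < m)%N ->
     unfolding_map s i (pt T (g (tau i.+1))) = pt T (g 0 + tau i.+1 *: v1) ->
     tessellation_edge T (s i) /\ segment (s i) (pt T (g 0 + tau i.+1 *: v1)).
  by move=> im e; have [h1 h2] := hs i im; rewrite -e.
have := H hs' m.-1; rewrite prednK // leqnn => /(_ isT); rewrite taum -eQ => e.
exists (L *: v1).
  by rewrite e eP ptD.
split.
- move: sP; rewrite -/(side T AY) eP => /segment_side -/(_ hT)[_ g0].
  rewrite /= in g0.
  by rewrite /pt (vecE hT) planeE /= g0 mulr0 addr0.
- case/andP: cv1 => c1 c2; apply/andP; rewrite !planeE.
  by split; [rewrite mulr_ge0 // ltW|rewrite ler_pM2l].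
- by rewrite !rate_sumZ rv1.
- by rewrite !qformZ qv1.
Qed.

(** The squared sine of the angle between v and the lines of the family a is
    3/4 ell a v ^+ 2 / qform v; it is between 1/4 and 3/4 for the family with the
    middle one of the three rates, the second coordinate if v is in the cone. *)
Lemma middle_axis v : exists a, qform v <= 3 * ell a v ^+ 2 <= 3 * qform v.
Proof.
have [m hm] := to_cone v; have [a [ha _]] := lin_bounce (R := R) m AY.
exists a; rewrite -[ell a v ^+ 2]real_normK ?num_real // -ha real_normK ?num_real //.
rewrite -(qform_lin m) /qform /=; move: hm; move: (lin m v) => w.
by case=> /andP[]; rewrite ?planeE => h1 h2; apply/andP; split; nra.
Qed.

(** The two symmetries that carry the side b to the base differ by the
    reflection in the vertical axis, so that one of them makes the horizontal
    component of a given vector nonnegative. *)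
Lemma sym_to_base b : exists m m',
  [/\ forall z, bary AY (sym m z) = bary b z :> R,
      forall z, bary AY (sym m' z) = bary b z :> R,
      forall z, (sym_lin m z).2 = bary_rate b z :> R
    & forall z : plane R, sym_lin m' z = (- (sym_lin m z).1 - (sym_lin m z).2, (sym_lin m z).2)].
Proof.
by case: b; [exists SR, (SF AD)|exists S1, (SF AY)|exists SRR, (SF AX)];
  split=> z; rewrite /sym_lin //=; try apply: plane_eq; rewrite /= ?planeE /=; ring.
Qed.

(** The line crosses a wall of the family found above.  A symmetry of the
    triangle carries the side struck at that time to the base. *)
Lemma start_position q g v : 0 < q -> coord_traj q g -> departs g 0 v ->
  exists m t0 w, let g' := fun t => sym m (g (t0 + t)) in
    [/\ (g' 0).2 = 0, departs g' 0 w & cone w].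
Proof.
move=> q0 tg dv; have [a ha] := middle_axis v.
have qv := traj_qform tg dv.
have av : ell a v != 0.
  apply/eqP => e; move: ha; rewrite e expr0n mulr0 qv => /andP[]; lra.
have [t0 t00 it] := reach (ell a (g 0)) 0 av.
have wt : wall a (g 0 + t0 *: v) by rewrite /wall ellD ellZ.
have [M [c [w [tc e dw ew]]]] := develop tg dv t00.
rewrite subr0 in e; rewrite -{}e in wt.
have [b [h1 [h2 _]]] := wall_lin M a tc.1; rewrite {}h1 in wt.
have [tt nt _] := tg t0; have bz := tri_wall tt nt wt.
have hb : qform w <= 3 * bary_rate b w ^+ 2 <= 3 * qform w.
  rewrite -[bary_rate b w ^+ 2]real_normK ?num_real // -ell_bary_rate -h2 ew.
  by rewrite real_normK ?num_real // -(qform_lin M) ew.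
have [m [m' [m1 m2 m3 m4]]] := sym_to_base b.
have ts := traj_shift t0 tg.
have dep n : departs (fun t => sym n (g (t0 + t))) 0 (sym_lin n w).
  by apply: filterS dw => h; rewrite !symE add0r addr0 => ->; rewrite sym_linD sym_linZ addrAC.
have pos : 0 <= bary_rate b w.
  have [d d0 Hd] := departs_nearby dw; have hd : 0 < d / 2 < d by apply/andP; split; lra.
  have [et _] := Hd _ hd; have [tt' _ _] := tg (t0 + d / 2).
  have := tt' b; rewrite et bary_rateE bz add0r pmulr_rge0 //; lra.
have pos' : 0 < bary_rate b w.
  rewrite lt_neqAle pos andbT eq_sym; apply/eqP => e0.
  move: hb; rewrite e0 expr0n mulr0 (traj_qform tg dw) => /andP[]; lra.
have qm : qform (sym_lin m w) = qform w := qform_sym m w.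
move: (m3 w) (m4 w) qm; case: (sym_lin m w) (dep m) => x y /= dm ey e4 qm.
rewrite -ey -qm /qform /= in hb pos'.
have [x0|x0] := lerP 0 x.
  exists m, t0, (x, y); split => //.
    by have := m1 (g t0); rewrite addr0 bz.
  by rewrite /cone /= x0; nra.
exists m', t0, (sym_lin m' w); split => //.
  by have := m2 (g t0); rewrite addr0 bz.
rewrite e4 /cone /=; case/andP: hb => hb1 hb2.
have h : x * (x + y) >= 0 by lra.
have xy : x + y <= 0 by nra.
by apply/andP; split; nra.
Qed.

Lemma enumerate (S : set R) L : finite_set S -> 0 < L -> S 0 -> S L ->
  (forall t, S t -> 0 <= t <= L) ->
  exists (m : nat) (tau : nat -> R), [/\ tau 0%N = 0, tau m = L,
    forall i, (i < m)%N -> tau i < tau i.+1 & tau @` [set i | (i <= m)%N] = S].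
Proof.
move=> /finite_fsetP[X ->] L0 S0 SL SI.
pose s := sort <=%O (X : seq R).
have us : uniq s by rewrite sort_uniq fset_uniq.
have ms t : (t \in s) = (t \in X) by rewrite mem_sort.
have lts : sorted <%O s by rewrite lt_sorted_uniq_le us sort_le_sorted.
have ss : (0 < size s)%N.
  by have : 0 \in s by [rewrite ms]; case: (s).
have mono i j : (i < j < size s)%N -> nth 0 s i < nth 0 s j.
  move=> /andP[ij js]; apply: (sorted_ltn_nth lt_trans) => //.
  by rewrite inE (ltn_trans ij).
have inS i : (i < size s)%N -> 0 <= nth 0 s i <= L.
  by move=> /(mem_nth 0); rewrite ms; exact: SI.
exists (size s).-1, (nth 0 s).
have last i : (i < size s)%N -> nth 0 s i <= nth 0 s (size s).-1.
  move=> i1; have : (i <= (size s).-1)%N by rewrite -ltnS prednK.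
  rewrite leq_eqVlt => /predU1P[->//|h]; apply/ltW/mono; by rewrite h prednK //=.
split.
- have : 0 \in s by rewrite ms.
  move=> /(nthP 0)[[|i] il e] //; have := mono 0%N i.+1; rewrite il e => /(_ isT).
  by have /andP[h _] := inS 0%N ss; rewrite ltNge h.
- have : L \in s by rewrite ms.
  move=> /(nthP 0)[i il e]; apply/eqP; rewrite eq_le -{2}e last //.
  by have /andP[_ ->] := inS (size s).-1 (ltac:(by rewrite prednK)).
- by move=> i im; apply: mono; rewrite ltnSn /= -(prednK ss) ltnS.
- apply/seteqP; split=> t.
    by move=> [i im <-] /=; rewrite -ms mem_nth // -(prednK ss) ltnS.
  rewrite /= -ms => /(nthP 0)[i il <-]; exists i => //=.
  by rewrite -ltnS prednK.
Qed.

(** The reflecting edges are chosen on the developed line, before the reflections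
    are known. *)
Lemma unfolding_exists o : periodic_orbit T o -> exists P Q, is_unfolding T o P Q.
Proof.
move=> po; have [q q0 [tg L0 per]] := periodic_coord po.
set c := co T \o curve o in tg per.
set L := finish o - start o in L0 per.
have [v [dv qv]] := traj_departs 0 tg.
have [m [t0 [w [base dw cw]]]] := start_position q0 tg dv.
set g := fun t => sym m (c (t0 + t)) in base dw.
have tgg : coord_traj q g by exact/traj_sym/traj_shift.
have gL : g L = g 0 by rewrite /g per addr0.
pose S := [set t | 0 <= t <= L /\ boundary T (pt T (g t))].
have w0 : w != 0.
  by apply: contraTneq q0 => w0; rewrite -(traj_qform tgg dw) w0 /qform /= !mulr0 !expr0n /= !addr0 ltxx.
have fS : finite_set S.
  have fin := line_finite (p := g 0) (a := 0) (L + 1) w0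
    (fun t (h : 0 <= t) => traj_no_lattice tgg dw h).
  apply: sub_finite_set fin => t [/andP[h1 h2] bt]; split.
    by apply/andP; split; lra.
  have [tt _ _] := tgg t; have /(traj_strike tgg dw h1) := (boundaryE hT tt).1 bt.
  by rewrite subr0.
have bd0 : boundary T (pt T (g 0)).
  by apply/boundaryE => //; [have [] := tgg 0|exists AY].
have [n [tau [tau0 taun taui img]]] : exists (m : nat) (tau : nat -> R),
    [/\ tau 0%N = 0, tau m = L, forall i, (i < m)%N -> tau i < tau i.+1
     & tau @` [set i | (i <= m)%N] = S].
  apply: enumerate => //.
  - by split=> //; rewrite lexx ltW.
  - by split; rewrite ?gL // lexx ltW.
  - by move=> t [].
have [free strike] := strike_times tgg taui img.
have edge i : exists e, (i < n)%N ->
    tessellation_edge T e /\ segment e (pt T (g 0 + tau i.+1 *: w)).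
  have [im|im] := boolP (i < n)%N; last by exists (vB T, vC T).
  have ti : 0 <= tau i.+1.
    by have := tau_mono taui (i := 0) (j := i.+1); rewrite tau0 im => /(_ isT) /ltW.
  have /(traj_strike tgg dw ti)[a] := strike i.+1 im.
  by rewrite subr0 => /(tess_exists hT)[e h1 h2]; exists e.
have [s hs] := choice edge.
have hstep i : (i.+1 < n)%N -> exists b, bary b (g (tau i.+1)) = 0.
  by move=> im; apply: strike; exact: ltnW.
have H := unfold_step tgg dw tau0 taui free hstep (s := s)
  (fun i im _ => hs i (ltnW im)).
exists (pt T (g 0)), (unfolding_map s n.-1 (pt T (g L))).
exists (pt T \o g), n, tau, s; split.
- exists (pt T \o sym m \o co T), t0, false; have [h1 h2] := sym_isometry hT m.
  by split=> // t; rewrite /g /c /= expr0 mul1r.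
- split=> //; first by apply/(segment_side hT AY); split=> //; have [] := tgg 0.
  have [w1 w2] := cone_dir hT cw w0.
  exists (vec T w); split=> //; first exact/departs_pt.
  exact/angle_cone.
- by split.
- by move=> i im; have [h1 h2] := hs i (ltnW im); rewrite /= H // ltnW.
- by [].
Qed.

End Unfolding.

(** * Counting the classes *)

Section Classes.
Local Open Scope classical_set_scope.
Local Open Scope ring_scope.
Context {R : realType} (T : triangle R) (hT : placed_equilateral T).
Implicit Types (z v w V : plane R) (t : R) (o : Defs.orbit R).

(** The vector V is a complete invariant for equivalence: unfoldings of o start
    on the base, so only their displacement matters up to horizontal
    translation. *)
Definition shape o V := periodic_orbit T o /\
  forall P Q, is_unfolding T o P Q -> P.2 = (vB T).2 /\ Q = P + vec T V.

Lemma shapeP o q v V : periodic_orbit T o -> coord_traj q (co T \o curve o) ->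
  departs (co T \o curve o) (start o) v -> cone V ->
  rate_sum ((finish o - start o) *: v) = rate_sum V ->
  qform ((finish o - start o) *: v) = qform V -> shape o V.
Proof.
move=> po tg dv cV rV qV; split=> // P Q uPQ.
have [W -> [-> cW rW qW]] := unfolding_vector hT po tg dv uPQ.
by rewrite (cone_inj cW cV) // ?rW ?qW.
Qed.

Lemma shape_equivalent o o' V : shape o V -> shape o' V -> equivalent T o o'.
Proof.
move=> [po ho] [po' ho'].
have [P [Q u]] := unfolding_exists hT po; have [P' [Q' u']] := unfolding_exists hT po'.
have [e eQ] := ho _ _ u; have [e' eQ'] := ho' _ _ u'.
exists P, Q, P', Q'; rewrite eQ eQ'.
split; [by rewrite -eQ|by rewrite -eQ'|exists (P'.1 - P.1)].
have E : P' = P + (P'.1 - P.1, 0).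
  by apply: plane_eq; rewrite planeE /= ?e ?e' ?addr0 // addrC subrK.
by split; [|rewrite {1}E addrAC].
Qed.

Lemma equivalent_shape o o' V : shape o V -> periodic_orbit T o' ->
  equivalent T o o' -> shape o' V.
Proof.
move=> [po ho] po' [P [Q [P' [Q' [u u' [c [eP eQ]]]]]]].
have [q q0 [tg _ _]] := periodic_coord hT po'.
have [v [dv _]] := traj_departs (start o') tg.
have [W eW [_ cW rW qW]] := unfolding_vector hT po' tg dv u'.
have -> : V = W; last exact: (shapeP po' tg dv).
have [_ eV] := ho _ _ u; apply: (vec_inj hT); apply: (addrI P').
by rewrite -eW eQ eV eP addrAC.
Qed.

Lemma shape_inj o V W : shape o V -> shape o W -> V = W.
Proof.
move=> [po hV] [_ hW]; have [P [Q u]] := unfolding_exists hT po.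
have [_ e] := hV _ _ u; have [_ e'] := hW _ _ u.
by apply: (vec_inj hT); apply: (addrI P); rewrite -e -e'.
Qed.

Lemma orbit_class_shape o V : shape o V -> orbit_class T o = [set o' | shape o' V].
Proof.
move=> sV; apply/seteqP; split=> o' /=.
  by move=> [po' eo']; exact: equivalent_shape sV po' eo'.
by move=> so'; split; [case: so'|exact: shape_equivalent sV so'].
Qed.

Definition lattice_vec (x d : nat) : plane R := (x%:R, (x + 3 * d)%:R).

Lemma cone_lattice_vec x d : cone (lattice_vec x d).
Proof. by rewrite /cone /= ler0n ler_nat leq_addr. Qed.

Lemma rate_sum_lattice_vec x d : rate_sum (lattice_vec x d) = (2 * (2 * x + 3 * d))%:R.
Proof.
by rewrite rate_sum_cone ?cone_lattice_vec //= -natrD -natrM; congr (_%:R); lia.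
Qed.

Lemma strikes_boundary q g a b : coord_traj q g ->
  [set t | a <= t < b /\ boundary T (pt T (g t))] =
  [set t | a <= t < b /\ exists c, bary c (g t) = 0].
Proof.
move=> tg; apply/seteqP; split=> t [tI h]; split=> //; have [tt _ _] := tg t.
  by apply/(boundaryE hT).
by apply/(boundaryE hT).
Qed.

Lemma shape_of_period o (n : nat) : periodic_orbit T o -> has_period T o (2 * n) ->
  exists x d : nat, n = (2 * x + 3 * d)%N /\ shape o (lattice_vec x d).
Proof.
move=> po hn; have [q q0 [tg L0 per]] := periodic_coord hT po.
have [v [dv _]] := traj_departs (start o) tg.
have [tV rV] : translation ((finish o - start o) *: v) /\
    rate_sum ((finish o - start o) *: v) = (2 * n)%:R.
  apply: (period_lattice q0 tg dv L0 per).
  rewrite subrKC -(strikes_boundary _ _ tg); move: hn; rewrite /has_period.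
  by under eq_set => t do rewrite -[curve o t](coK hT).
have [x [d [en qV]]] := lattice_type tV rV.
exists x, d; split=> //; apply: (shapeP po tg dv) => //.
  exact: cone_lattice_vec.
by rewrite rV en rate_sum_lattice_vec.
Qed.

(** Starting from the abscissa 1 / (2y) on the base, the line of direction (x, y)
    avoids the vertices: at a lattice point, 1 / 2 would be an integer
    combination of the coordinates. *)
Lemma shape_realized x d : (0 < 2 * x + 3 * d)%N -> exists o,
  [/\ periodic_orbit T o, has_period T o (2 * (2 * x + 3 * d)) & shape o (lattice_vec x d)].
Proof.
move=> n0; set v := lattice_vec x d; set y := (x + 3 * d)%N.
have y0 : (0 : R) < y%:R by rewrite ltr0n /y; lia.
have v0 : v != 0.
  by apply/eqP => /(congr1 snd) /= e; move: y0; rewrite /y -e ltxx.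
pose p : plane R := ((2 * y%:R)^-1, 0).
have nl t : ~ lattice (p + t *: v).
  move=> [i1 i2].
  have : (2 : R)^-1 \is a Num.int.
    rewrite (_ : 2^-1 = (p + t *: v).1 * y%:R - (p + t *: v).2 * x%:R).
      by rewrite rpredB // rpredM ?rpred_nat.
    rewrite !planeE /= -/y; move: (y%:R) (gt_eqF y0) => Y /negbT Y0; field.
    by rewrite Y0.
  by move=> h; have := int_between h; case; lra.
pose g t := fold (p + t *: v).
have tg : coord_traj (qform v) g := fold_traj v0 nl.
have q0 := qform_gt0 v0.
have tv : translation v.
  split; first by split; rewrite rpred_nat.
  rewrite /= natrD opprD addrA subrr add0r natrM -mulrN mulrC mulKf ?pnatr_eq0 //.
  by rewrite rpredN rpred_nat.
pose o := Orbit (pt T \o g) 0 1.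
have per t : g (0 + t) = g (1 + t).
  rewrite add0r /g; have [h1 h2] := foldP (p + t *: v).
  apply/esym/fold_eq => //; apply: weyl_eq_trans h2; apply: weyl_eq_sym.
  by exists S1, v; split=> //=; rewrite scalerDl scale1r addrA addrAC.
have po : periodic_orbit T o.
  split=> //=; first exact: (traj_of_coord hT q0 tg).
  by move=> t; rewrite /= per.
have cg : co T \o curve o = g by apply/funext => t; rewrite /= ptK.
have dv : departs g 0 v.
  have y1 : (2 * y%:R)^-1 < 1 :> R.
    rewrite invf_lt1 ?mulr_gt0 //.
    have : 1 <= y%:R :> R by rewrite ler1n -(ltr0n R).
    by lra.
  have pp : 0 < (2 * y%:R)^-1 :> R by rewrite invr_gt0 mulr_gt0.
  have tp : in_tri p by case; rewrite /=; lra.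
  have [e e0 He] : exists2 e : R, 0 < e & forall h : R, 0 < h < e -> in_tri (p + h *: v).
    apply: inward => //; case; rewrite /= => e; [lra|exact: ltW|lra].
  have fp w : in_tri w -> fold w = w.
    by move=> tw; apply: fold_eq => //; exact: weyl_eq_refl.
  apply/near_rightP; exists e => // h hh.
  by rewrite /g add0r scale0r addr0 !fp //; exact: He.
exists o; split=> //.
- have L1 : (0 : R) < 1 by [].
  have := traj_count q0 tg dv L1; rewrite scale1r => /(_ tv.1)[M eM].
  move: eM; rewrite rate_sum_lattice_vec => /eqP; rewrite eqr_nat => /eqP ->.
  by rewrite /has_period /= add0r -(strikes_boundary _ _ tg).
- apply: (shapeP (q := qform v) (v := v) po); rewrite ?cg //= ?subr0 ?scale1r //.
  exact: cone_lattice_vec.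
Qed.

Definition class_count (n : nat) := if (n %% 6 == 1)%N then (n %/ 6)%N else (n %/ 6 + 1)%N.

Lemma class_countE (n : nat) : (0 < n)%N ->
  (class_count n)%:Z = ((n + 2) %/ 2)%N%:Z - ((n + 2) %/ 3)%N%:Z.
Proof. by rewrite /class_count; case: ifP => /eqP; lia. Qed.

(** The admissible first coordinates are the numbers in the residue class of 2n
    modulo three that do not exceed n / 2. *)
Lemma class_index (n : nat) : (0 < n)%N ->
  forall x, (exists d, n = (2 * x + 3 * d)%N) <->
            (exists2 k, (k < class_count n)%N & x = ((2 * n) %% 3 + 3 * k)%N).
Proof.
move=> n0 x; rewrite /class_count; split=> [[d en]|[k + ->]].
  exists (x %/ 3)%N; last by lia.
  by case: ifP => /eqP; lia.
move=> kn; exists ((n - 2 * ((2 * n) %% 3 + 3 * k)) %/ 3)%N.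
by move: kn; case: ifP => /eqP; lia.
Qed.

Lemma classes_card (n : nat) : (0 < n)%N ->
  (classes_of_period T (2 * n) #= `I_(class_count n))%card.
Proof.
move=> n0; have idx := class_index n0.
pose r := ((2 * n) %% 3)%N.
pose dk k := ((n - 2 * (r + 3 * k)) %/ 3)%N.
have en k : (k < class_count n)%N -> n = (2 * (r + 3 * k) + 3 * dk k)%N.
  move=> kn; have [d hd] : exists d, n = (2 * (r + 3 * k) + 3 * d)%N.
    by apply/idx; exists k.
  by rewrite /dk; lia.
have ex k : exists o, (k < class_count n)%N ->
    [/\ periodic_orbit T o, has_period T o (2 * n) & shape o (lattice_vec (r + 3 * k) (dk k))].
  have [kn|kn] := boolP (k < class_count n)%N; last by exists (Orbit (fun=> 0) 0 0).
  have e := en k kn; have [|o] := shape_realized (x := r + 3 * k) (d := dk k).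
    by rewrite -e.
  by rewrite -e => h; exists o.
have [rep hrep] := choice ex.
have -> : classes_of_period T (2 * n) = (fun k => orbit_class T (rep k)) @` `I_(class_count n).
  apply/seteqP; split=> C.
    move=> [orb [po hp] <-]; have [x [d [e so]]] := shape_of_period po hp.
    have [k kn ex'] : exists2 k, (k < class_count n)%N & x = (r + 3 * k)%N.
      by apply/idx; exists d.
    exists k => //; have [_ _ sk] := hrep k kn.
    rewrite (orbit_class_shape sk) (orbit_class_shape so) -ex'.
    by rewrite (_ : dk k = d) // /dk -ex'; lia.
  move=> [k kn <-]; have [po hp _] := hrep k kn; by exists (rep k).
apply: inj_card_eq => k l /set_mem kn /set_mem ln eC.
have [pk _ sk] := hrep k kn; have [_ _ sl] := hrep l ln.
have : orbit_class T (rep k) (rep k) by rewrite (orbit_class_shape sk).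
rewrite [orbit_class T (rep k)]eC (orbit_class_shape sl) => /(shape_inj sk) /(congr1 fst) /= /eqP.
by rewrite eqr_nat => /eqP; lia.
Qed.

End Classes.

Theorem theorem5 (R : realType) (T : triangle R) (hT : placed_equilateral T)
    (n : nat) (hn : (0 < n)%N) :
  let On := (if (n %% 6 == 1)%N then (n %/ 6)%N else (n %/ 6 + 1)%N) in
  (classes_of_period T (2 * n) #= `I_On)%card /\
  (On%:Z = ((n + 2) %/ 2)%N%:Z - ((n + 2) %/ 3)%N%:Z)%R.
Proof.
by split; [exact: classes_card|exact: class_countE].
Qed.
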